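(* Assume that the coarse Ricci curvature of the Markov chain (with respect to the graph distance $d_g$) is bounded from below by $\kappa_c>0$. Then for every probability density $f$ with respect to $\pi$, $$W_{1}(f\pi,\pi)^2\leq \frac{1}{\kappa_c^2}\,\mathcal{I}_\pi(f)\left(J-\frac{1}{8}\mathcal{I}_\pi(f)\right) \leq \frac{1}{\kappa_c^2}\,\mathcal{I}_\pi(f).$$
   Context: Setting: $\mathcal{X}$ is a finite or countably infinite set and $K$ is an irreducible Markov kernel on $\mathcal{X}$, with $\sum_y K(x,y)=1$ for all $x\in\mathcal{X}$. $\pi$ is a reversible invariant probability measure: $K(x,y)\pi(x)=K(y,x)\pi(y)$ for all $x,y$. $J(x)=1-K(x,x)$ and $J=\sup_{x}J(x)$, so $0<J\le1$. The generator is $Lf(x)=\sum_y (f(y)-f(x))K(x,y)$, $P_t=e^{tL}$ is the associated semigroup acting on functions, and $P_t^*$ its adjoint acting on measures. $\Gamma(f)(x)=\frac12\sum_y (f(y)-f(x))^2K(x,y)$. Distance: $d_g(x,y)$ is the smallest $n\in\mathbb{N}$ such that there exist $x_0=x,\dots,x_n=y$ with $K(x_i,x_{i+1})>0$ for $0\le i\le n-1$. $W_1$ is the $L^1$-Wasserstein distance on $(\mathcal{X},d_g)$: $W_1(\mu,\nu)=\inf\int d_g(x,y)\,q(dx\,dy)$ over all couplings $q$ of $\mu,\nu$. Curvature: the coarse Ricci curvature is bounded from below by $\kappa_c$ if for all probability measures $\mu,\nu$ and all $t\ge0$, $W_1(P_t^*\mu,P_t^*\nu)\le e^{-\kappa_c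 t}W_1(\mu,\nu)$. Fisher information: for $f\ge 0$, $\mathcal{I}_\pi(f)=4\int\Gamma(\sqrt f)\,d\pi=2\sum_x\sum_y(\sqrt{f(y)}-\sqrt{f(x)})^2K(x,y)\pi(x)$. *)

(* Defs.v *)
From HB Require Import structures.
From mathcomp Require Import all_boot all_order all_algebra.
From mathcomp Require Import all_classical all_reals all_analysis.

Set Implicit Arguments.
Unset Strict Implicit.
Unset Printing Implicit Defensive.

Import Order.TTheory GRing.Theory Num.Theory.
Import numFieldNormedType.Exports.

Local Open Scope classical_set_scope.
Local Open Scope ring_scope.
Local Open Scope ereal_scope.

(* A finite or countably infinite state space is modelled as a countable
   measurable space in which every set is measurable.  A probability measure is
   then determined by the masses [mu [set x]], the number written K(x,y) on
   paper is [K x [set y]], and sum_y g(y) K(x,y) is [\int[K x]_y g y]. *)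
Definition countable_discrete d (X : measurableType d) : Prop :=
  countable [set: X] /\ forall A : set X, measurable A.

Section MarkovChain.
Context {d : measure_display} {X : measurableType d} {R : realType}.
Implicit Types (K : R.-pker X ~> X) (pi : probability X R) (g f : X -> R).
Implicit Types (mu nu : set X -> \bar R).

Definition walk K (n : nat) (x y : X) : Prop :=
  exists p : seq X,
    [/\ size p = n, path (fun u v : X => 0 < K u [set v]) x p & last x p = y].

Definition irreducible K : Prop := forall x y : X, exists n, walk K n x y.

Definition reversible K pi : Prop :=
  forall x y : X, K x [set y] * pi [set x] = K y [set x] * pi [set y].

(* J(x) = 1 - K(x,x) and J = sup_x J(x) *)
Definition jump_rate K (x : X) : \bar R := 1 - K x [set x].

Definition max_jump_rate K : \bar R := ereal_sup (range (jump_rate K)).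

Definition generator K g : X -> R :=
  fun x => Rintegral (K x) setT (fun y => (g y - g x)%R).

(* P_t = e^{tL} = sum_n t^n / n! L^n; as L is a bounded operator on the bounded
   functions, the series converges for every bounded g. *)
Definition semigroup K (t : R) g : X -> R :=
  fun x => limn (series (fun n => t ^+ n / n`!%:R * iter n (generator K) g x)%R).

(* The adjoint is characterized by int g d(P_t^* mu) = int P_t g d(mu), here
   for g the indicator of A. *)
Definition semigroup_adj K (t : R) (mu : probability X R) : set X -> \bar R :=
  fun A => \int[mu]_x (semigroup K t \1_A x)%:E.

Definition carre_du_champ K g (x : X) : \bar R :=
  (2^-1)%:E * \int[K x]_y ((g y - g x) ^+ 2)%:E.

(* The smallest n such that there is a walk of length n (an infimum of a set of
   natural numbers is attained unless the set is empty; it is +oo in that case,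
   which irreducibility rules out). *)
Definition graph_dist K (x y : X) : \bar R :=
  ereal_inf [set n%:R%:E | n in [set n : nat | walk K n x y]].

Definition coupling mu nu (q : probability (X * X)%type R) : Prop :=
  forall A : set X, measurable A ->
    q (A `*` setT) = mu A /\ q (setT `*` A) = nu A.

Definition W1 K mu nu : \bar R :=
  ereal_inf [set \int[q]_z graph_dist K z.1 z.2 | q in coupling mu nu].

Definition coarse_ricci_ge K (kappa : R) : Prop :=
  forall (mu nu : probability X R) (t : R), (0 <= t)%R ->
    W1 K (semigroup_adj K t mu) (semigroup_adj K t nu)
      <= (expR (- kappa * t))%:E * W1 K mu nu.

Definition prob_density pi f : Prop :=
  (forall x, 0 <= f x)%R /\ \int[pi]_x (f x)%:E = 1.

Definition density_measure f pi : set X -> \bar R :=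
  fun A => \int[pi]_(x in A) (f x)%:E.

Definition fisher_info K pi f : \bar R :=
  4%:E * \int[pi]_x carre_du_champ K (fun y => Num.sqrt (f y)) x.

End MarkovChain.

(* Main.v *)
Require Import Defs.
From HB Require Import structures.
From mathcomp Require Import all_boot all_order all_algebra.
From mathcomp Require Import all_classical all_reals all_analysis.
From mathcomp Require Import zify ring lra.

(** Write mu = f pi, W = W1(mu, pi) and A for half the integral of |f x - f y|
    against pi(dx) K(x,dy).  The theorem is the conjunction of two bounds:
    kappa W <= A, and A^2 <= (1/2) I (J - I/8).

    First bound.  For small t, the triangle inequality through P_t^* mu and the
    contraction of W1 (recall P_t^* pi = pi) give
    W <= W1(mu, P_t^* mu) + e^(-kappa t) W.  The heat kernel is reversible, so mu
    is carried to P_t^* mu by the plan that moves only the net flow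
    (f x - f y)^+ along pi(dx) p_t(x,dy) ([flow_coupling]).  To first order in t
    only edges of the graph are used, each of length at most 1, so this plan
    costs t A + O(t^2) ([semigroup_cost]); dividing by t and letting t tend to 0
    yields kappa W <= A ([W1_le_downhill_flow]).  This argument stays on the side
    of couplings and uses no Kantorovich duality.  It needs W finite and the
    O(t^2) uniform; both follow from a Bonnet-Myers bound on the diameter
    ([bounded_diameter]), itself a consequence of the contraction of Dirac
    masses.  The triangle inequality for W1 is a gluing of couplings
    ([coupling_glue]).

    Second bound.  Write |f x - f y| as the product of |sqrt(f x) - sqrt(f y)|
    and sqrt(f x) + sqrt(f y), and apply Cauchy-Schwarz off the diagonal.  The
    two squares add up to 2 (f x + f y), whose integral off the diagonal is
    4 times that of f J against pi, at most 4 J; one of them integrates to I/2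
    ([downhill_flow_fisher]).  In particular I <= 8 J, so J - I/8 >= 0 and the
    factor 1/2 may be dropped; since J <= 1, the last inequality follows too. *)

Import Order.TTheory GRing.Theory Num.Theory.
Import numFieldNormedType.Exports.
Local Open Scope classical_set_scope.
Local Open Scope ring_scope.
Local Open Scope ereal_scope.

Set Implicit Arguments.
Unset Strict Implicit.
Unset Printing Implicit Defensive.

(** * Sigma-additive functionals on a countable discrete space *)

Lemma eq_indic (R : pzRingType) T U (A : set T) (B : set U) t u :
  (A t <-> B u) -> \1_A t = \1_B u :> R.
Proof.
move=> AB; rewrite !indicE; congr (_%:R); congr nat_of_bool.
exact/asbool_equiv_eq.
Qed.

Lemma countable_discreteX d (T : measurableType d) d' (U : measurableType d') :
  countable_discrete T -> countable_discrete U ->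
  countable_discrete (T * U)%type.
Proof.
move=> [cT mT] [cU mU].
have cTU : countable [set: T * U] by rewrite -setXTT; exact: countableX.
split=> // A; apply: countable_measurable; last first.
  by apply: (sub_countable _ cTU); exact: subset_card_le.
move=> [t u]; rewrite (_ : [set (t, u)] = [set t] `*` [set u]).
  by apply: measurableX; [exact: mT|exact: mU].
by apply/seteqP; split=> [[a b] [-> ->]//|[a b] /= [-> ->]].
Qed.

Section SigmaFunctionals.
Context {R : realType}.

(** The abstract properties of an integral of nonnegative functions.  Couplings
    below are described by iterated integrals of test functions; this is the
    form in which they can be composed without any measurability argument. *)
Definition sigma_functional T (I : (T -> \bar R) -> \bar R) : Prop :=
  [/\ forall F, (forall t, 0 <= F t) -> 0 <= I F,
      forall c F, 0 <= c -> (forall t, 0 <= F t) ->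
        I (fun t => c * F t) = c * I F
    & forall F : nat -> T -> \bar R, (forall n t, 0 <= F n t) ->
        I (fun t => \sum_(n <oo) F n t) = \sum_(n <oo) I (F n)].

Lemma nneseriesZl_ge0 (f : nat -> \bar R) (c : \bar R) :
  (forall n, 0 <= f n) -> 0 <= c ->
  \sum_(n <oo) (c * f n) = c * \sum_(n <oo) f n.
Proof.
move=> f0; case: c => [r _| _|//]; first by rewrite nneseriesZl.
have [fz|] := pselect (forall n, f n = 0).
  rewrite [X in _ = _ * X]eseries0; last by move=> n _ _; rewrite fz.
  by rewrite mule0 eseries0// => n _ _; rewrite fz mule0.
move=> /existsNP[k /eqP fk].
have fk0 : 0 < f k by rewrite lt_neqAle eq_sym fk f0.
have inf0 n : 0 <= +oo * f n by rewrite mule_ge0// leey.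
rewrite [RHS]gt0_mulye; last first.
  rewrite (lt_le_trans fk0)// (@nneseriesD1 _ f k predT)//.
  by rewrite leeDl// nneseries_ge0.
rewrite (@nneseriesD1 _ (fun n => +oo * f n) k predT)//.
rewrite gt0_mulye// addye// gt_eqF//.
by rewrite (@lt_le_trans _ _ 0)// nneseries_ge0.
Qed.

Lemma measurable_fun_discrete d (T : measurableType d) d' (T' : sigmaRingType d')
    (mT : forall A : set T, measurable A) (D : set T) (f : T -> T') :
  measurable_fun D f.
Proof. by move=> ? ? ?; exact: mT. Qed.

Lemma sigma_functional_integral d (T : measurableType d)
    (mT : forall A : set T, measurable A) (m : {measure set T -> \bar R}) :
  sigma_functional (fun F => \int[m]_t F t).
Proof.
split=> [F F0|c F c0 F0|F F0]; first exact: integral_ge0.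
- by rewrite ge0_integralZl//.
- by rewrite integral_nneseries// => n; exact: measurable_fun_discrete.
Qed.

Lemma integral_prob_cst d (T : measurableType d) (m : probability T R) (c : \bar R) :
  \int[m]_t c = c.
Proof. by rewrite integral_cst//= probability_setT mule1. Qed.

Lemma sigma_functional_weight T U (I : (T -> \bar R) -> \bar R)
    (w : T -> \bar R) (g : T -> U) : (forall t, 0 <= w t) ->
  sigma_functional I -> sigma_functional (fun F => I (fun t => w t * F (g t))).
Proof.
move=> w0 [I0 IZ IS]; split=> [F F0|c F c0 F0|F F0].
- by apply: I0 => t; rewrite mule_ge0.
- rewrite -IZ//; last by move=> t; rewrite mule_ge0.
  by congr I; apply/funext => t; rewrite muleCA.
- rewrite -IS; last by move=> n t; rewrite mule_ge0.
  by congr I; apply/funext => t; rewrite nneseriesZl_ge0.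
Qed.

Lemma sigma_functionalD T (I J : (T -> \bar R) -> \bar R) :
  sigma_functional I -> sigma_functional J ->
  sigma_functional (fun F => I F + J F).
Proof.
move=> [I0 IZ IS] [J0 JZ JS]; split=> [F F0|c F c0 F0|F F0].
- by rewrite adde_ge0; [|exact: I0|exact: J0].
- by rewrite IZ// JZ// ge0_muleDr; [|exact: I0|exact: J0].
- by rewrite IS// JS// nneseriesD// => n _ _; [exact: I0|exact: J0].
Qed.

Lemma sigma_functional_iter T U (I : (T -> \bar R) -> \bar R)
    (J : T -> (U -> \bar R) -> \bar R) :
  sigma_functional I -> (forall t, sigma_functional (J t)) ->
  sigma_functional (fun F => I (fun t => J t F)).
Proof.
move=> [I0 IZ IS] sJ.
have J0 t F : (forall u, 0 <= F u) -> 0 <= J t F by case: (sJ t) => + _ _; apply.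
split=> [F F0|c F c0 F0|F F0].
- by apply: I0 => t; exact: J0.
- rewrite -IZ//; last by move=> t; exact: J0.
  by congr I; apply/funext => t; have [_ + _] := sJ t; apply.
- rewrite -IS//; last by move=> n t; exact: J0.
  by congr I; apply/funext => t; have [_ _ +] := sJ t; apply.
Qed.

(** On a countable space a nonnegative function is the series of its values
    times the indicators of points, so a functional is determined by the masses
    of points.  This replaces Fubini and change of variables throughout: two
    ways of integrating agree as soon as they agree on points. *)
Lemma eq_sigma_functional T (I J : (T -> \bar R) -> \bar R) :
  countable [set: T] -> sigma_functional I -> sigma_functional J ->
  (forall t, I (fun u => (\1_[set t] u)%:E) = J (fun u => (\1_[set t] u)%:E)) ->
  forall F, (forall t, 0 <= F t) -> I F = J F.
Proof.
move=> /countable_injP[e /in2TT einj] [I0 IZ IS] [J0 JZ JS] IJ F F0.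
(* [G n] is F restricted to the only point that [e] numbers n, if any. *)
pose G n t := if e t == n then F t else 0.
have G0 n t : 0 <= G n t by rewrite /G; case: ifP.
have -> : F = fun t => \sum_(n <oo) G n t.
  apply/funext => t; rewrite (@nneseriesD1 _ (G ^~ t) (e t) predT)//.
  rewrite /G eqxx eseries0 ?adde0// => n _ /= /negbTE.
  by rewrite eq_sym => ->.
rewrite IS// JS//; apply: eq_eseriesr => n _.
have [[t et]|nt] := pselect (exists t, e t = n).
  have -> : G n = fun u => F t * (\1_[set t] u)%:E.
    apply/funext => u; rewrite /G indicE.
    have [ut|ut] := pselect (u = t); first by rewrite ut et eqxx mem_set// mule1.
    case: eqP => [eu|_]; first by case: ut; apply: einj; rewrite eu et.
    by rewrite memNset ?mule0.
  by rewrite IZ ?JZ ?IJ// => u; rewrite lee_fin.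
have -> : G n = fun u => 0 * 0.
  by apply/funext => u; rewrite /G mule0; case: eqP => // eu; case: nt; exists u.
by rewrite IZ// JZ// !mul0e.
Qed.

(** The measure is A |-> I(1_A); that it represents I is
    [eq_sigma_functional].  All couplings are built with this lemma. *)
Lemma sigma_functional_prob d (T : measurableType d)
    (I : (T -> \bar R) -> \bar R) :
  countable_discrete T -> sigma_functional I -> I (fun=> 1) = 1 ->
  exists p : probability T R,
    forall F, (forall t, 0 <= F t) -> \int[p]_t F t = I F.
Proof.
move=> [cT mT] sI I1; have [I0 IZ IS] := sI.
pose mu (A : set T) := I (fun t => (\1_A t)%:E).
have mu0 : mu set0 = 0.
  rewrite /mu [X in I X](_ : _ = fun=> 0 * 0); first by rewrite IZ// mul0e.
  by apply/funext => t; rewrite indic0 mule0.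
have mu_ge0 A : 0 <= mu A by apply: I0 => t; rewrite lee_fin.
have muS : semi_sigma_additive mu.
  move=> F _ tF _.
  have -> : mu (\bigcup_n F n) = \sum_(n <oo) mu (F n).
    rewrite /mu -IS; last by move=> n t; rewrite lee_fin.
    congr I; apply/funext => t.
    have [[n _ Fnt]|nF] := pselect ((\bigcup_n F n) t).
      rewrite indicE mem_set; last by exists n.
      rewrite (@nneseriesD1 _ (fun n => (\1_(F n) t)%:E) n predT)//.
      rewrite indicE mem_set// eseries0 ?adde0// => k _ /= kn.
      rewrite indicE memNset// => Fkt.
      by move/negP: kn; apply; apply/eqP; apply: (tF k n) => //; exists t.
    rewrite indicE memNset// eseries0// => k _ _.
    by rewrite indicE memNset// => Fkt; apply: nF; exists k.
  by apply: is_cvg_nneseries => n _ _.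
pose mixin := isMeasure.Build _ _ _ mu mu0 mu_ge0 muS.
pose m0 : {measure set T -> \bar R} := HB.pack mu mixin.
have m1 : m0 setT = 1.
  by rewrite -I1; congr I; apply/funext => t; rewrite indicT.
pose m : probability T R :=
  HB.pack mu mixin (Measure_isProbability.Build _ _ _ m0 m1).
exists m => F F0.
apply: (eq_sigma_functional cT (sigma_functional_integral mT m) sI) => // t.
by rewrite integral_indic// setIT.
Qed.

End SigmaFunctionals.

(** * The semigroup on bounded functions *)

Lemma series_tail_le {R : realType} (u e : R^nat) (U E C : R) (k : nat) :
  series u @ \oo --> U -> series e @ \oo --> E ->
  (forall n, (k <= n)%N -> (`|u n| <= C * e n)%R) ->
  (`|U - series u k| <= C * (E - series e k))%R.
Proof.
move=> cu ce ue.
have tail n : (k <= n)%N ->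
    (`|series u n - series u k| <= C * (series e n - series e k))%R.
  move=> kn; rewrite !sub_series_geq//.
  rewrite (le_trans (ler_norm_sum _ _ _))// mulr_sumr.
  rewrite big_nat_cond [leRHS]big_nat_cond ler_sum// => i /andP[/andP[ki _] _].
  exact: ue.
have cf : (fun n => `|series u n - series u k|)%R @ \oo --> (`|U - series u k|)%R.
  by apply: cvg_norm; apply: cvgB => //; exact: cvg_cst.
have cg : (fun n => C * (series e n - series e k))%R @ \oo --> (C * (E - series e k))%R.
  by apply: cvgM; [exact: cvg_cst|apply: cvgB => //; exact: cvg_cst].
rewrite -(cvg_lim (@Rhausdorff R) cf) -(cvg_lim (@Rhausdorff R) cg).
apply: ler_lim; [by apply/cvg_ex; exists (`|U - series u k|)%R
  |by apply/cvg_ex; exists (C * (E - series e k))%R|].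
by exists k => // n /= kn; exact: tail.
Qed.

Lemma cvg_series_dominated {R : realType} (u e : R^nat) (C : R) :
  cvgn (series e) -> (forall n, (`|u n| <= C * e n)%R) -> cvgn (series u).
Proof.
move=> ce ue; apply: normed_cvg.
apply: (@series_le_cvg _ _ (C *: e)); last exact: is_cvg_seriesZ.
- by move=> n /=.
- by move=> n; apply: le_trans (ue n).
- by move=> n; exact: ue.
Qed.

Section BoundedIntegrals.
Context {d : measure_display} {T : measurableType d} {R : realType}.
Variable m : {measure set T -> \bar R}.
Hypothesis mT : forall A : set T, measurable A.
Hypothesis m1 : m setT = 1.
Implicit Types (g h : T -> R) (M N : R).

Lemma bounded_integrable g M : (forall x, `|g x| <= M)%R ->
  m.-integrable setT (EFin \o g).
Proof.
move=> gM; apply: measurable_bounded_integrable => //.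
- by rewrite m1 ltry.
- exists M; split=> [|N MN x _ /=]; first exact: num_real.
  by rewrite (le_trans (gM x))// ltW.
Qed.

Lemma normr_Rintegral_le g M : (forall x, `|g x| <= M)%R ->
  (`|Rintegral m setT g| <= M)%R.
Proof.
move=> gM; rewrite (le_trans (le_normr_Rintegral _ (bounded_integrable gM)))//.
have -> : M = Rintegral m setT (cst M) by rewrite Rintegral_cst// m1 mulr1.
apply: le_Rintegral => //.
- by apply: (@bounded_integrable _ M) => x; rewrite normr_id.
- by apply: (@bounded_integrable _ `|M|%R).
Qed.

Lemma Rintegral_lin g h M N (a b : R) :
  (forall x, `|g x| <= M)%R -> (forall x, `|h x| <= N)%R ->
  Rintegral m setT (fun x => a * g x + b * h x)%R =
  (a * Rintegral m setT g + b * Rintegral m setT h)%R.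
Proof.
move=> gM hN; have ig := bounded_integrable gM; have ih := bounded_integrable hN.
rewrite RintegralD//.
- by rewrite !RintegralZl.
- apply: (@bounded_integrable _ (`|a| * M)%R) => x.
  by rewrite normrM ler_wpM2l.
- apply: (@bounded_integrable _ (`|b| * N)%R) => x.
  by rewrite normrM ler_wpM2l.
Qed.

Lemma Rintegral_EFin g M : (forall x, `|g x| <= M)%R ->
  \int[m]_x (g x)%:E = (Rintegral m setT g)%:E.
Proof. by move=> gM; rewrite fineK// integrable_fin_num// (bounded_integrable gM). Qed.

Lemma Rintegral_indic A : Rintegral m setT \1_A = fine (m A).
Proof. by rewrite /Rintegral integral_indic// setIT. Qed.

End BoundedIntegrals.

Section Semigroup.
Context {d : measure_display} {X : measurableType d} {R : realType}.
Variable K : R.-pker X ~> X.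
Hypothesis mX : forall A : set X, measurable A.
Implicit Types (g h : X -> R) (M N c t : R) (x : X).

Local Notation L := (generator K).
Let K1 x : K x setT = 1 := @prob_kernel _ _ _ _ _ K x.

Lemma normr_increment_le g M x y : (forall x, `|g x| <= M)%R ->
  (`|g y - g x| <= 2 * M)%R.
Proof.
move=> gM; rewrite (le_trans (ler_normB _ _))//.
by rewrite mulr_natl mulr2n lerD.
Qed.

Lemma generator_le g M : (forall x, `|g x| <= M)%R ->
  forall x, (`|L g x| <= 2 * M)%R.
Proof.
by move=> gM x; apply: normr_Rintegral_le => // y; exact: normr_increment_le.
Qed.

Lemma iter_generator_le g M n : (forall x, `|g x| <= M)%R ->
  forall x, (`|iter n L g x| <= 2 ^+ n * M)%R.
Proof.
move=> gM; elim: n => [|n IH] x; first by rewrite expr0 mul1r.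
by rewrite iterS exprS -mulrA; exact: generator_le.
Qed.

Lemma generator_lin g h M N (a b : R) :
  (forall x, `|g x| <= M)%R -> (forall x, `|h x| <= N)%R ->
  L (fun x => a * g x + b * h x)%R = (fun x => a * L g x + b * L h x)%R.
Proof.
move=> gM hN; apply/funext => x; rewrite /generator.
rewrite -(@Rintegral_lin _ _ _ _ _ _ _ _ (2 * M)%R (2 * N)%R)//.
- by apply: eq_Rintegral => y _; rewrite opprD addrACA -!mulrBr.
- by move=> y; exact: normr_increment_le.
- by move=> y; exact: normr_increment_le.
Qed.

Lemma iter_generator_lin g h M N (a b : R) n :
  (forall x, `|g x| <= M)%R -> (forall x, `|h x| <= N)%R ->
  iter n L (fun x => a * g x + b * h x)%R =
  (fun x => a * iter n L g x + b * iter n L h x)%R.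
Proof.
move=> gM hN; elim: n => [//|n IH]; rewrite !iterS IH.
by apply: generator_lin; exact: iter_generator_le.
Qed.

Definition semigroup_coeff t g x : R^nat :=
  fun n => (t ^+ n / n`!%:R * iter n L g x)%R.

Lemma normr_semigroup_coeff_le t g x c k n : (0 <= t)%R ->
  (forall y, `|iter k L g y| <= c)%R -> (k <= n)%N ->
  (`|semigroup_coeff t g x n| <= c / 2 ^+ k * exp_coeff (2 * t) n)%R.
Proof.
move=> t0 gc kn; rewrite /semigroup_coeff /exp_coeff/=.
rewrite normrM ger0_norm; last by rewrite divr_ge0// exprn_ge0.
have -> : iter n L g = iter (n - k) L (iter k L g) by rewrite -iterD subnK.
apply: (@le_trans _ _ (t ^+ n / n`!%:R * (2 ^+ (n - k) * c)))%R.
  rewrite ler_wpM2l//; first by rewrite divr_ge0// exprn_ge0.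
  exact: iter_generator_le.
have -> : ((2 * t) ^+ n = 2 ^+ (n - k) * 2 ^+ k * t ^+ n)%R.
  by rewrite exprMn -exprD subnK.
rewrite le_eqVlt; apply/orP; left; apply/eqP.
field; rewrite pnatr_eq0 -lt0n fact_gt0/=.
by rewrite expf_neq0.
Qed.

Lemma semigroup_coeff_cvg t g x M : (0 <= t)%R -> (forall y, `|g y| <= M)%R ->
  series (semigroup_coeff t g x) @ \oo --> semigroup K t g x.
Proof.
move=> t0 gM.
apply: (cvg_series_dominated (is_cvg_series_exp_coeff (2 * t)%R)) => n.
by apply: (@normr_semigroup_coeff_le _ _ _ M 0%N); rewrite ?expr0 ?divr1.
Qed.

(** As L has norm at most 2 on bounded functions, the remainder after k terms is
    controlled by a bound c on L^k g alone and by the exponential series of 2t.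
    For k = 1 this matters: L g can be small while g itself is not. *)
Lemma semigroup_taylor t g x M c k : (0 <= t)%R -> (forall y, `|g y| <= M)%R ->
  (forall y, `|iter k L g y| <= c)%R ->
  (`|semigroup K t g x - series (semigroup_coeff t g x) k|
    <= c / 2 ^+ k * (expR (2 * t) - series (exp_coeff (2 * t)) k))%R.
Proof.
move=> t0 gM gc; apply: series_tail_le.
- exact: semigroup_coeff_cvg gM.
- exact: is_cvg_series_exp_coeff.
- by move=> n kn; exact: normr_semigroup_coeff_le.
Qed.

Lemma normr_semigroup_le t g x M : (0 <= t)%R -> (forall y, `|g y| <= M)%R ->
  (`|semigroup K t g x| <= M * expR (2 * t))%R.
Proof.
move=> t0 gM; have := @semigroup_taylor t g x M M 0 t0 gM gM.
by rewrite /series/= !big_geq// !subr0 expr0 divr1.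
Qed.

Lemma semigroup_order1 t g x M c : (0 <= t)%R -> (forall y, `|g y| <= M)%R ->
  (forall y, `|L g y| <= c)%R ->
  (`|semigroup K t g x - g x| <= c / 2 * (expR (2 * t) - 1))%R.
Proof.
move=> t0 gM gc; have := @semigroup_taylor t g x M c 1 t0 gM gc.
by rewrite /series/= !big_nat1 /semigroup_coeff/exp_coeff/= !expr0 expr1 divr1 mul1r.
Qed.

Lemma semigroup_order2 t g x M : (0 <= t)%R -> (forall y, `|g y| <= M)%R ->
  (`|semigroup K t g x - g x - t * L g x| <= M * (expR (2 * t) - 1 - 2 * t))%R.
Proof.
move=> t0 gM.
have := @semigroup_taylor t g x M (2 ^+ 2 * M)%R 2 t0 gM (iter_generator_le 2 gM).
rewrite (_ : 2 ^+ 2 * M / 2 ^+ 2 = M)%R; last by field.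
rewrite /series/= !big_nat_recr//= !big_geq// !add0r.
rewrite /semigroup_coeff/exp_coeff/= !expr0 !expr1 !divr1 mul1r.
by rewrite !opprD !addrA.
Qed.

Lemma semigroup_lin t g h M N (a b : R) x : (0 <= t)%R ->
  (forall x, `|g x| <= M)%R -> (forall x, `|h x| <= N)%R ->
  semigroup K t (fun x => a * g x + b * h x)%R x =
  (a * semigroup K t g x + b * semigroup K t h x)%R.
Proof.
move=> t0 gM hN.
have cg := @semigroup_coeff_cvg t g x M t0 gM.
have ch := @semigroup_coeff_cvg t h x N t0 hN.
apply: (cvg_lim (@Rhausdorff R)).
rewrite (_ : series _ = fun n => a * series (semigroup_coeff t g x) n +
    b * series (semigroup_coeff t h x) n)%R.
  by apply: cvgD; apply: cvgM => //; exact: cvg_cst.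
apply/funext => n; rewrite /series/= !mulr_sumr -big_split/=.
apply: eq_bigr => i _; rewrite (iter_generator_lin a b i gM hN).
by rewrite /semigroup_coeff; ring.
Qed.

End Semigroup.

(** * The graph distance *)

Section GraphDistance.
Context {d : measure_display} {X : measurableType d} {R : realType}.
Variables (K : R.-pker X ~> X) (pi : probability X R).
Hypothesis cX : countable_discrete X.
Hypothesis irrK : irreducible K.
Hypothesis revK : reversible K pi.
Implicit Types x y z : X.

Local Notation edge := (fun u v : X => 0 < K u [set v]).

(** If no point had mass, pi would agree on points with the zero functional. *)
Lemma exists_atom : exists x, 0 < pi [set x].
Proof.
apply: contrapT => noatom.
have pi0 x : pi [set x] = 0.
  apply/eqP; rewrite eq_le measure_ge0 andbT leNgt.
  by apply/negP => ?; apply: noatom; exists x.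
have sJ : sigma_functional (fun _ : X -> \bar R => 0 : \bar R).
  by split=> [//|c F _ _|F _]; rewrite ?mule0// eseries0.
have I1 : \int[pi]_x (cst 1 x) = 1.
  by rewrite integral_prob_cst.
have I0 : \int[pi]_x (cst 1 x) = 0.
  apply: (eq_sigma_functional cX.1 (sigma_functional_integral cX.2 pi) sJ) => //.
  move=> t; rewrite integral_indic//=; [by rewrite setIT pi0|exact: cX.2].
by move: I1; rewrite I0 => /esym/eqP; rewrite onee_eq0.
Qed.

Lemma walk0 x : walk K 0 x x.
Proof. by exists [::]. Qed.

Lemma walk1 x y : edge x y -> walk K 1 x y.
Proof. by move=> xy; exists [:: y]; rewrite /= xy. Qed.

Lemma walk_cat m n x y z : walk K m x y -> walk K n y z -> walk K (m + n) x z.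
Proof.
move=> [p [<- xp <-]] [q [<- yq <-]]; exists (p ++ q).
by rewrite size_cat cat_path xp yq last_cat.
Qed.

Lemma reverse_edge x y : 0 < pi [set x] -> edge x y ->
  0 < pi [set y] /\ edge y x.
Proof.
move=> px xy; have : 0 < K y [set x] * pi [set y] by rewrite -revK mule_gt0.
have [->|y0] := eqVneq (pi [set y]) 0; first by rewrite mule0 ltxx.
have [->|yx0] := eqVneq (K y [set x]) 0; first by rewrite mul0e ltxx.
by rewrite !lt0e y0 yx0 !measure_ge0.
Qed.

(** Reversibility carries positive mass along an edge, and irreducibility joins
    every point to an atom. *)
Lemma pi_gt0 x : 0 < pi [set x].
Proof.
have [x0 px0] := exists_atom; have [n [p [_ xp <-]]] := irrK x0 x.
elim: p x0 px0 xp => [//|y p IH] x0 px0 /= /andP[e xp].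
by apply: IH => //; have [] := reverse_edge px0 e.
Qed.

Lemma edge_sym x y : edge x y -> edge y x.
Proof. by move=> /(reverse_edge (pi_gt0 x))[]. Qed.

Lemma walk_sym n x y : walk K n x y -> walk K n y x.
Proof.
move=> [p [pn xp py]]; exists (rev (belast x p)); split.
- by rewrite size_rev size_belast.
- rewrite -py rev_path; apply: sub_path xp => u v; exact: edge_sym.
- by rewrite -py; case: p {xp py pn} => [|a p]//=; rewrite rev_cons last_rcons.
Qed.

Lemma graph_dist_nat : exists D : X -> X -> nat,
  [/\ forall x y, graph_dist K x y = (D x y)%:R%:E,
      forall x y, walk K (D x y) x y
    & forall n x y, walk K n x y -> (D x y <= n)%N].
Proof.
have minwalk x y : exists n, walk K n x y /\ forall m, walk K m x y -> (n <= m)%N.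
  have [n0 w0] := irrK x y.
  have ex : exists n, `[< walk K n x y >] by exists n0; apply/asboolP.
  have [n /asboolP wn nmin] := ex_minnP ex.
  by exists n; split=> // m wm; apply: nmin; apply/asboolP.
pose D x y := projT1 (cid (minwalk x y)).
have DP x y : walk K (D x y) x y /\ forall m, walk K m x y -> (D x y <= m)%N.
  exact: projT2 (cid (minwalk x y)).
exists D; split=> [x y|x y|n x y w]; [|exact: (DP x y).1|exact: (DP x y).2].
apply/eqP; rewrite eq_le; apply/andP; split.
  by apply: ereal_inf_lbound; exists (D x y) => //; exact: (DP x y).1.
apply/ereal_infP => _ [n wn <-].
by rewrite lee_fin ler_nat; exact: (DP x y).2.
Qed.

(** The distance is natural-valued by irreducibility and symmetric by
    reversibility. *)
Lemma graph_dist_metric : exists D : X -> X -> nat,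
  [/\ forall x y, graph_dist K x y = (D x y)%:R%:E,
      forall x, D x x = 0%N,
      forall x y z, (D x z <= D x y + D y z)%N,
      forall x y, D x y = D y x
    & forall x y, edge x y -> (D x y <= 1)%N].
Proof.
have [D [DE Dw Dmin]] := graph_dist_nat; exists D; split=> //.
- by move=> x; apply/eqP; rewrite -leqn0; apply: Dmin; exact: walk0.
- by move=> x y z; apply: Dmin; exact: walk_cat (Dw x y) (Dw y z).
- move=> x y; apply/eqP; rewrite eqn_leq.
  by rewrite (Dmin _ _ _ (walk_sym (Dw y x))) (Dmin _ _ _ (walk_sym (Dw x y))).
- by move=> x y xy; apply: Dmin; exact: walk1.
Qed.

End GraphDistance.

(** * Mass flow of a reversible kernel *)

Section Flow.
Context {d : measure_display} {X : measurableType d} {R : realType}.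
Hypothesis cX : countable_discrete X.
Implicit Types (m : probability X R) (k : X -> {measure set X -> \bar R}).

Let mX : forall A : set X, measurable A := cX.2.

(** The integral of F against the law of one step of k started from m. *)
Definition flow m k (F : X * X -> \bar R) : \bar R :=
  \int[m]_x \int[k x]_y F (x, y).

Lemma sigma_functional_comp T U (I : (T -> \bar R) -> \bar R) (g : T -> U) :
  sigma_functional I -> sigma_functional (fun F => I (F \o g)).
Proof.
move=> sI; have := sigma_functional_weight g (fun=> lee01) sI.
by congr sigma_functional; apply/funext => F; congr I; apply/funext => t; rewrite mul1e.
Qed.

Lemma sigma_functional_flow m k : sigma_functional (flow m k).
Proof.
apply: sigma_functional_iter; first exact: sigma_functional_integral.
by move=> x; apply: (sigma_functional_comp (pair x)); exact: sigma_functional_integral.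
Qed.

Lemma flow_indic1 m k x y :
  flow m k (fun z => (\1_[set (x, y)] z)%:E) = k x [set y] * m [set x].
Proof.
rewrite /flow (_ : (fun _ => _) = fun u => k x [set y] * (\1_[set x] u)%:E).
  by rewrite ge0_integralZl// integral_indic// setIT.
apply/funext => u; have [->|ux] := eqVneq u x.
  rewrite indicE mem_set// mule1 -[X in k x X]setIT -integral_indic//.
  by apply: eq_integral => v _; rewrite !indicE !in_set1 xpair_eqE eqxx.
rewrite indicE in_set1 (negbTE ux) mule0 integral0_eq// => v _.
by rewrite indicE in_set1 xpair_eqE (negbTE ux).
Qed.

Lemma flow_swap m k : (forall x y, k x [set y] * m [set x] = k y [set x] * m [set y]) ->
  forall F, (forall z, 0 <= F z) -> flow m k F = flow m k (fun z => F (z.2, z.1)).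
Proof.
move=> sym F F0.
pose J G := flow m k (G \o (fun z => (z.2, z.1))).
have sJ : sigma_functional J.
  by apply: sigma_functional_comp; exact: sigma_functional_flow.
have [cXX _] := countable_discreteX cX cX.
apply: (@eq_sigma_functional _ _ (flow m k) J cXX (sigma_functional_flow m k) sJ _ F F0).
move=> [x y]; rewrite flow_indic1 sym -flow_indic1; congr flow.
by apply/funext => -[u v] /=; rewrite !indicE !in_set1 !xpair_eqE andbC.
Qed.

Lemma flowD m k (F G : X * X -> \bar R) :
  (forall z, 0 <= F z) -> (forall z, 0 <= G z) ->
  flow m k (fun z => F z + G z) = flow m k F + flow m k G.
Proof.
move=> F0 G0; rewrite /flow -ge0_integralD//; last 2 first.
- by move=> x _; exact: integral_ge0.
- by move=> x _; exact: integral_ge0.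
by apply: eq_integral => x _; rewrite ge0_integralD.
Qed.

Lemma flowZ m k (c : R) F : (0 <= c)%R -> (forall z, 0 <= F z) ->
  flow m k (fun z => c%:E * F z) = c%:E * flow m k F.
Proof.
move=> c0 F0; case: (sigma_functional_flow m k) => _ + _.
by apply; rewrite ?lee_fin.
Qed.

Lemma le_flow m k F G : (forall z, 0 <= F z) -> (forall z, F z <= G z) ->
  flow m k F <= flow m k G.
Proof.
move=> F0 FG; apply: ge0_le_integral => //.
  by move=> x _; exact: integral_ge0.
by move=> x _; apply: ge0_le_integral.
Qed.

End Flow.

(** * The heat kernel and its reversibility *)

Section HeatKernel.
Context {d : measure_display} {X : measurableType d} {R : realType}.
Variables (K : R.-pker X ~> X) (pi : probability X R).
Hypothesis cX : countable_discrete X.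
Implicit Types (g h : X -> R) (M N t : R) (x y : X).

Let mX : forall A : set X, measurable A := cX.2.
Let K1 x : K x setT = 1 := @prob_kernel _ _ _ _ _ K x.
Let pi1 : pi setT = 1 := probability_setT pi.

Lemma normr_indic_le1 (A : set X) y : (`|\1_A y : R| <= 1)%R.
Proof. by rewrite ger0_norm// indicE lern1; case: (_ \in _). Qed.

Definition is_heat_kernel t (p : X -> probability X R) :=
  forall x A, p x A = (semigroup K t \1_A x)%:E.

(** The curvature bound for the Dirac mass at x, coupled with itself, gives
    W1(P_t^* delta_x, P_t^* delta_x) <= 0.  An infimum over no coupling would be
    infinite, so P_t^* delta_x is the marginal of a probability measure.  The
    positivity of P_t is thus read off the hypothesis instead of the series. *)
Lemma exists_heat_kernel kappa t : (0 <= t)%R -> coarse_ricci_ge K kappa ->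
  exists p, is_heat_kernel t p.
Proof.
move=> t0 ricci.
suff H x : exists p : probability X R, forall A, p A = (semigroup K t \1_A x)%:E.
  by have [p pP] := choice H; exists p.
pose dx : probability X R := \d_x.
have adjE A : semigroup_adj K t dx A = (semigroup K t \1_A x)%:E.
  by rewrite /semigroup_adj integral_dirac// diracT mul1e.
have W0 : W1 K dx dx < +oo.
  apply: (@le_lt_trans _ _ 0); last exact: ltry.
  apply: ge_ereal_inf; exists 0; last by [].
  exists \d_(x, x).
    by move=> A _; split; rewrite /= /dirac; congr EFin; apply: eq_indic => /=;
      split=> [[]|].
  have [_ mXX] := countable_discreteX cX cX.
  rewrite integral_dirac ?diracT ?mul1e//=.
  apply/eqP; rewrite eq_le; apply/andP; split.
    by apply: ereal_inf_lbound; exists 0%N => //; exists [::].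
  by apply/ereal_infP => _ [n _ <-]; rewrite lee_fin.
have : W1 K (semigroup_adj K t dx) (semigroup_adj K t dx) < +oo.
  by rewrite (le_lt_trans (ricci dx dx t t0))// lte_mul_pinfty// lee_fin expR_ge0.
move=> /ereal_inf_lt[_ [q qP <-] _].
pose I F := \int[q]_z F z.1 : \bar R.
have [_ mXX] := countable_discreteX cX cX.
have sI : sigma_functional I.
  by apply: (sigma_functional_comp fst); exact: sigma_functional_integral.
have [|p pI] := sigma_functional_prob cX sI.
  by rewrite /I integral_prob_cst.
exists p => A; have [qA _] := qP A (mX A).
rewrite -adjE -qA -[A in LHS]setIT -integral_indic// pI; last first.
  by move=> u; rewrite lee_fin.
rewrite /I -[A `*` setT in RHS]setIT -integral_indic//.
  apply: eq_integral => -[u v] _ /=; congr EFin.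
  by apply: eq_indic => /=; split=> [|[]].
Qed.

(** Both sides are linear in g and bounded by its supremum, and they agree on
    indicators.  Subtracting M/2 on the set where g >= M/2 halves the bound M,
    hence halves the possible discrepancy; iterating, it vanishes. *)
Lemma heat_kernel_Rintegral t (p : X -> probability X R) : (0 <= t)%R ->
  is_heat_kernel t p -> forall x g M, (forall y, 0 <= g y <= M)%R ->
  Rintegral (p x) setT g = semigroup K t g x.
Proof.
move=> t0 pP x g M gM; apply/eqP; rewrite -subr_eq0 -normr_le0.
have p1 : p x setT = 1 := probability_setT (p x).
pose err g := (Rintegral (p x) setT g - semigroup K t g x)%R.
pose C := (1 + expR (2 * t))%R.
have gbd g' M' : (forall y, 0 <= g' y <= M')%R -> forall y, (`|g' y| <= M')%R.
  by move=> gM' y; have /andP[g0 gle] := gM' y; rewrite ger0_norm.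
have errC g' M' : (forall y, 0 <= g' y <= M')%R -> (`|err g'| <= C * M')%R.
  move=> /gbd gM'; rewrite (le_trans (ler_normB _ _))// /C mulrDl mul1r lerD//.
    exact: normr_Rintegral_le.
  by rewrite mulrC; exact: normr_semigroup_le.
have errA A : err \1_A = 0%R.
  by rewrite /err Rintegral_indic//= pP subrr.
have half n : forall g' M', (forall y, 0 <= g' y <= M')%R ->
    (`|err g'| <= C * (M' / 2 ^+ n))%R.
  elim: n => [|n IH] g' M' gM'; first by rewrite expr0 divr1; exact: errC.
  pose A := [set y | (M' / 2 <= g' y)%R].
  pose r y := (1 * g' y + (- (M' / 2)) * \1_A y)%R.
  have -> : err g' = err r.
    rewrite /err /r (Rintegral_lin mX p1 _ _ (gbd _ _ gM') (normr_indic_le1 A)).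
    rewrite (semigroup_lin K mX _ _ _ t0 (gbd _ _ gM') (normr_indic_le1 A)).
    have := errA A; rewrite /err => /eqP; rewrite subr_eq0 => /eqP ->.
    by ring.
  have -> : (M' / 2 ^+ n.+1 = M' / 2 / 2 ^+ n)%R.
    by rewrite exprS invfM mulrA.
  apply: IH => y; have /andP[g0 gle] := gM' y.
  rewrite /r indicE mul1r; have [Ay|nAy] := pselect (A y).
    by rewrite mem_set// mulr1; move: Ay; rewrite /A/= => Ay; apply/andP; split; lra.
  rewrite memNset// mulr0 addr0 g0/=; apply/ltW; rewrite ltNge; exact/negP.
have lim0 : (fun n => C * (M / 2 ^+ n))%R @ \oo --> (C * 0)%R.
  apply: cvgM; first exact: cvg_cst.
  have := @cvg_geometric R M 2^-1; rewrite ger0_norm// => /(_ _).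
  rewrite (_ : geometric _ _ = fun n => M / 2 ^+ n)%R; first by apply; lra.
  by apply/funext => n; rewrite /geometric/= exprVn.
rewrite mulr0 in lim0.
rewrite -(cvg_lim (@Rhausdorff R) lim0); apply: limr_ge.
  by apply/cvg_ex; exists 0%R.
by apply: nearW => n; exact: half.
Qed.

Hypothesis revK : reversible K pi.

Let iterated (F : X -> X -> R) : R :=
  Rintegral pi setT (fun x => Rintegral (K x) setT (F x)).

(** Reversibility for signed functions, reduced to the nonnegative case by adding
    a constant. *)
Lemma Rintegral_swap (F : X -> X -> R) M : (forall x y, `|F x y| <= M)%R ->
  iterated F = iterated (fun x y => F y x).
Proof.
suff pos (G : X -> X -> R) N : (forall x y, 0 <= G x y <= N)%R ->
    iterated G = iterated (fun x y => G y x).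
  move=> FM.
  have shift (G : X -> X -> R) : (forall x y, `|G x y| <= M)%R ->
      iterated (fun x y => 1 * G x y + M * cst 1 y)%R = (iterated G + M)%R.
    move=> GM; rewrite /iterated.
    have c1 (y : X) : (`|cst 1 y : R| <= 1)%R by rewrite normr1.
    under eq_Rintegral => x _ do rewrite (Rintegral_lin mX (K1 x) _ _ (GM x) c1)
      Rintegral_cst//= K1 mulr1.
    have := Rintegral_lin mX pi1 1 M (g := fun x => Rintegral (K x) setT (G x)) _ c1.
    move=> /(_ M) ->; first by rewrite Rintegral_cst//= pi1 !mulr1 mul1r.
    by move=> x; exact: normr_Rintegral_le.
  apply: (addIr M); rewrite -(shift F FM) -(shift (fun x y => F y x) (fun x y => FM y x)).
  apply: (pos _ (2 * M)%R) => x y; have := FM x y.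
  by rewrite ler_norml /= => /andP[? ?]; apply/andP; split; lra.
move=> GN.
have flowE (H : X -> X -> R) : (forall x y, 0 <= H x y <= N)%R ->
    (iterated H)%:E = flow pi K (fun z => (H z.1 z.2)%:E).
  move=> HN; have Hbd x y : (`|H x y| <= N)%R.
    by have /andP[H0 Hle] := HN x y; rewrite ger0_norm.
  rewrite /iterated -(Rintegral_EFin mX pi1 (M := N)); last first.
    by move=> x; exact: normr_Rintegral_le.
  by apply: eq_integral => x _; rewrite -(Rintegral_EFin mX (K1 x) (Hbd x)).
apply: EFin_inj.
rewrite (flowE G GN) (flowE (fun x y => G y x) (fun x y => GN y x)).
rewrite (flow_swap cX revK)// => z.
by rewrite lee_fin; have /andP[] := GN z.1 z.2.
Qed.

Lemma generator_adjoint g h M N :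
  (forall x, `|g x| <= M)%R -> (forall x, `|h x| <= N)%R ->
  Rintegral pi setT (fun x => g x * generator K h x)%R =
  Rintegral pi setT (fun x => h x * generator K g x)%R.
Proof.
move=> gM hN.
have expand (u v : X -> R) B C : (forall x, `|u x| <= B)%R -> (forall x, `|v x| <= C)%R ->
    Rintegral pi setT (fun x => u x * generator K v x)%R =
    (iterated (fun x y => u x * v y) - Rintegral pi setT (fun x => u x * v x))%R.
  move=> uB vC.
  have uvbd x y : (`|u x * v y| <= B * C)%R by rewrite normrM ler_pM.
  have c1 (x : X) : (`|cst 1 x : R| <= 1)%R by rewrite normr1.
  have gE x : (u x * generator K v x =
      1 * Rintegral (K x) setT (fun y => u x * v y) + (- 1) * (u x * v x))%R.
    rewrite /generator.
    under eq_Rintegral => y _ do rewrite -[v y]mul1r -[v x]mulr1 -mulNr.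
    rewrite (Rintegral_lin mX (K1 x) _ _ vC c1) Rintegral_cst//= K1.
    by rewrite RintegralZl ?(bounded_integrable mX (K1 x) vC)//=; ring.
  under eq_Rintegral => x _ do rewrite gE.
  rewrite (@Rintegral_lin _ _ _ pi mX pi1 _ _ (B * C)%R (B * C)%R).
  - by rewrite /iterated; ring.
  - by move=> x; exact: normr_Rintegral_le.
  - by move=> x; exact: uvbd.
rewrite (expand g h M N)// (expand h g N M)//; congr (_ - _)%R.
  rewrite (@Rintegral_swap _ (M * N)%R).
    by apply: eq_Rintegral => x _; apply: eq_Rintegral => y _; rewrite mulrC.
  by move=> x y; rewrite normrM ler_pM.
by apply: eq_Rintegral => x _; rewrite mulrC.
Qed.

Lemma iter_generator_adjoint n g h M N :
  (forall x, `|g x| <= M)%R -> (forall x, `|h x| <= N)%R ->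
  Rintegral pi setT (fun x => g x * iter n (generator K) h x)%R =
  Rintegral pi setT (fun x => h x * iter n (generator K) g x)%R.
Proof.
elim: n g M => [|n IH] g M gM hN.
  by apply: eq_Rintegral => x _; rewrite mulrC.
under eq_Rintegral => x _ do rewrite iterS.
rewrite (generator_adjoint gM (iter_generator_le K mX n hN)).
under eq_Rintegral => x _ do rewrite mulrC.
rewrite (IH _ (2 * M)%R)//; last exact: generator_le.
by apply: eq_Rintegral => x _; rewrite iterSr.
Qed.

Lemma Rintegral_indic1 x g : Rintegral pi setT (fun u => \1_[set x] u * g u)%R =
  (fine (pi [set x]) * g x)%R.
Proof.
transitivity (Rintegral pi setT (fun u => g x * \1_[set x] u + 0 * \1_[set x] u)%R).
  apply: eq_Rintegral => u _; rewrite mul0r addr0 mulrC indicE in_set1.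
  by have [->//|_] := eqVneq u x; rewrite !mulr0.
have bd := normr_indic_le1 [set x].
by rewrite (Rintegral_lin mX pi1 _ _ bd bd) Rintegral_indic// mul0r addr0 mulrC.
Qed.

(** L is self-adjoint in L^2(pi), hence so are its powers; testing on indicators
    of points makes every coefficient of the two exponential series agree. *)
Lemma heat_kernel_reversible t (p : X -> probability X R) : (0 <= t)%R ->
  is_heat_kernel t p ->
  forall x y, p x [set y] * pi [set x] = p y [set x] * pi [set y].
Proof.
move=> t0 pP x y; rewrite !pP.
have cvgxy u v : (fun n =>
    fine (pi [set u]) * series (semigroup_coeff K t \1_[set v] u) n)%R
    @ \oo --> (fine (pi [set u]) * semigroup K t \1_[set v] u)%R.
  apply: cvgM; first exact: cvg_cst.
  exact: (semigroup_coeff_cvg mX t0 (normr_indic_le1 [set v])).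
have fK u : (fine (pi [set u]))%:E = pi [set u].
  by rewrite fineK// fin_num_measure.
rewrite -(fK x) -(fK y) -!EFinM; congr EFin; rewrite mulrC [RHS]mulrC.
apply: (cvg_unique _ (cvgxy x y)); first exact: Rhausdorff.
rewrite (_ : (fun n => _) = fun n =>
  fine (pi [set y]) * series (semigroup_coeff K t \1_[set x] y) n)%R; first exact: cvgxy.
apply/funext => n; rewrite /series/= !mulr_sumr; apply: eq_bigr => i _.
rewrite /semigroup_coeff mulrCA [RHS]mulrCA; congr (_ * _)%R.
rewrite -!Rintegral_indic1.
exact: (iter_generator_adjoint _ (normr_indic_le1 _) (normr_indic_le1 _)).
Qed.

End HeatKernel.

(** * Gluing couplings *)

Section Gluing.
Context {d : measure_display} {X : measurableType d} {R : realType}.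
Hypothesis cX : countable_discrete X.
Implicit Types (mu nu rho : set X -> \bar R) (q : probability (X * X)%type R).

Let cXX : countable_discrete (X * X)%type := countable_discreteX cX cX.

Lemma integral_mul_indic1 d' (T : measurableType d') (m : {measure set T -> \bar R})
    (F : T -> \bar R) t : (forall A : set T, measurable A) -> (forall u, 0 <= F u) ->
  \int[m]_u (F u * (\1_[set t] u)%:E) = F t * m [set t].
Proof.
move=> mT F0.
transitivity (\int[m]_u (F t * (\1_[set t] u)%:E)).
  apply: eq_integral => u _; rewrite indicE in_set1.
  by have [->//|_] := eqVneq u t; rewrite !mule0.
by rewrite ge0_integralZl// integral_indic// setIT.
Qed.

(** The glued plan draws u from q1, then v from q2 conditionally on v.1 = u.2, and
    keeps (u.1, v.2).  As a density with respect to q1 x q2 the conditioning is the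
    weight 1[u.2 = v.1] / rho{v.1}; because rho is a marginal of both plans, u and
    v still have laws q1 and q2 under it. *)
Lemma coupling_glue mu rho nu q1 q2 :
  coupling mu rho q1 -> coupling rho nu q2 ->
  exists2 q, coupling mu nu q &
    forall F : X * X -> \bar R, (forall z, 0 <= F z) ->
      (forall x y z, F (x, z) <= F (x, y) + F (y, z)) ->
      \int[q]_z F z <= \int[q1]_z F z + \int[q2]_z F z.
Proof.
move=> c1 c2; have [ctXX mXX] := cXX; have [_ mX] := cX.
have rhoE1 y : q1 (setT `*` [set y]) = rho [set y] by case: (c1 [set y] (mX _)).
have rhoE2 y : q2 ([set y] `*` setT) = rho [set y] by case: (c2 [set y] (mX _)).
pose s y := (fine (rho [set y]))^-1%:E.
have rho_ge0 y : 0 <= rho [set y] by rewrite -rhoE1.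
have s0 y : 0 <= s y by rewrite lee_fin invr_ge0 fine_ge0.
have srho y : rho [set y] != 0 -> s y * rho [set y] = 1.
  move=> r0; rewrite /s -{2}(@fineK _ (rho [set y])); last first.
    by rewrite -rhoE1 fin_num_measure.
  rewrite -EFinM mulVf// fine_eq0// -rhoE1 fin_num_measure//.
pose w (u v : X * X) := s v.1 * (\1_[set v.1] u.2)%:E.
have w0 u v : 0 <= w u v by rewrite mule_ge0.
pose J (G : (X * X) * (X * X) -> \bar R) :=
  \int[q1]_u \int[q2]_v (w u v * G (u, v)).
have sJ : sigma_functional J.
  apply: sigma_functional_iter; first exact: sigma_functional_integral.
  move=> u; apply: (sigma_functional_weight (pair u) (w0 u)).
  exact: sigma_functional_integral.
have JD (G H : (X * X) * (X * X) -> \bar R) :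
    (forall z, 0 <= G z) -> (forall z, 0 <= H z) ->
    J (fun z => G z + H z) = J G + J H.
  move=> G0 H0; rewrite /J -ge0_integralD//; last 2 first.
  - by move=> u _; apply: integral_ge0 => v _; rewrite mule_ge0.
  - by move=> u _; apply: integral_ge0 => v _; rewrite mule_ge0.
  apply: eq_integral => u _; rewrite -ge0_integralD//; last 2 first.
  - by move=> v _; rewrite mule_ge0.
  - by move=> v _; rewrite mule_ge0.
  by apply: eq_integral => v _; rewrite ge0_muleDr.
have J1 (G : X * X -> \bar R) : (forall z, 0 <= G z) -> J (G \o fst) = \int[q1]_u G u.
  move=> G0.
  have sJ1 : sigma_functional (fun G : X * X -> \bar R => J (G \o fst)).
    exact: sigma_functional_comp.
  apply: (eq_sigma_functional ctXX sJ1 (sigma_functional_integral mXX q1)) => // u0.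
  rewrite /J integral_indic// setIT.
  transitivity (\int[q1]_u ((\int[q2]_v w u v) * (\1_[set u0] u)%:E)).
    apply: eq_integral => u _.
    rewrite muleC -ge0_integralZl//; apply: eq_integral => v _.
    by rewrite muleC.
  rewrite integral_mul_indic1//; last by move=> u; exact: integral_ge0.
  have -> : \int[q2]_v w u0 v = s u0.2 * rho [set u0.2].
    rewrite -rhoE2 -[_ `*` _]setIT -integral_indic// -ge0_integralZl//.
    apply: eq_integral => v _; rewrite /w.
    have [e|ne] := eqVneq v.1 u0.2.
      by rewrite e; congr (_ * _%:E); apply: eq_indic => /=.
    rewrite !indicE memNset ?memNset ?mule0//=.
      by move=> [e _]; rewrite e eqxx in ne.
    by move=> e; rewrite e eqxx in ne.
  (* A point whose second coordinate is rho-null is q1-null. *)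
  have [r0|r0] := eqVneq (rho [set u0.2]) 0; last by rewrite srho// mul1e.
  rewrite r0 mule0 mul0e; apply/esym/eqP; rewrite -measure_le0 -r0 -rhoE1.
  by apply: le_measure; rewrite ?inE// => _ ->.
have J2 (G : X * X -> \bar R) : (forall z, 0 <= G z) -> J (G \o snd) = \int[q2]_v G v.
  move=> G0.
  have sJ2 : sigma_functional (fun G : X * X -> \bar R => J (G \o snd)).
    exact: sigma_functional_comp.
  apply: (eq_sigma_functional ctXX sJ2 (sigma_functional_integral mXX q2)) => // v0.
  rewrite /J integral_indic// setIT.
  transitivity (\int[q1]_u ((s v0.1 * q2 [set v0]) * (\1_[set v0.1] u.2)%:E)).
    apply: eq_integral => u _.
    by rewrite integral_mul_indic1// /w muleAC.
  rewrite ge0_integralZl//; last by rewrite mule_ge0.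
  have -> : \int[q1]_u (\1_[set v0.1] u.2)%:E = rho [set v0.1].
    rewrite -rhoE1 -[_ `*` _]setIT -integral_indic//.
    by apply: eq_integral => u _; congr EFin; apply: eq_indic; split=> [|[]].
  rewrite muleAC; have [r0|r0] := eqVneq (rho [set v0.1]) 0; last by rewrite srho// mul1e.
  rewrite r0 mule0 mul0e; apply/esym/eqP; rewrite -measure_le0 -r0 -rhoE2.
  by apply: le_measure; rewrite ?inE// => _ ->.
pose I (F : X * X -> \bar R) := J (fun z => F (z.1.1, z.2.2)).
have sI : sigma_functional I by exact: sigma_functional_comp.
have [|q qI] := sigma_functional_prob cXX sI.
  by rewrite /I (J1 (fun=> 1))// integral_prob_cst.
exists q => [A mA|F F0 tri]; last first.
  rewrite qI// -(J1 F)// -(J2 F)// -JD//; last 2 first.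
  - by move=> z /=.
  - by move=> z /=.
  apply: ge0_le_integral => //.
  - by move=> u _; apply: integral_ge0 => v _; rewrite mule_ge0.
  move=> [x y] _; apply: ge0_le_integral => //.
  - by move=> v _; rewrite mule_ge0.
  move=> [y' z] _ /=; have [->|ne] := eqVneq y y'; first by rewrite lee_pmul.
  by rewrite /w/= indicE in_set1 (negbTE ne) mule0 !mul0e.
split.
- rewrite -[A `*` _]setIT -integral_indic// qI; last by move=> z; rewrite lee_fin.
  case: (c1 A mA) => <- _; rewrite -[A `*` _ in RHS]setIT -integral_indic// -J1.
    by congr J; apply/funext => z /=; congr EFin; apply: eq_indic; split=> -[].
  by move=> z; rewrite lee_fin.
- rewrite -[_ `*` A]setIT -integral_indic// qI; last by move=> z; rewrite lee_fin.
  case: (c2 A mA) => _ <-; rewrite -[_ `*` A in RHS]setIT -integral_indic// -J2.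
    by congr J; apply/funext => z /=; congr EFin; apply: eq_indic; split=> -[].
  by move=> z; rewrite lee_fin.
Qed.

End Gluing.

(** * Bounded diameter under positive curvature *)

Section Support.
Context {d : measure_display} {T : measurableType d} {R : realType}.
Hypothesis cT : countable_discrete T.
Variable m : {measure set T -> \bar R}.

Let mT : forall A : set T, measurable A := cT.2.

(** Points of mass zero are negligible, as there are countably many of them. *)
Lemma le_integral_support (F G : T -> \bar R) : (forall t, 0 <= F t) ->
  (forall t, 0 <= G t) -> (forall t, 0 < m [set t] -> F t <= G t) ->
  \int[m]_t F t <= \int[m]_t G t.
Proof.
move=> F0 G0 FG; pose N := [set t | m [set t] = 0].
pose H t := (1 - \1_N t)%R%:E * F t.
have H0 t : 0 <= (1 - \1_N t)%:E :> \bar R.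
  by rewrite lee_fin subr_ge0 indicE lern1; case: (_ \in _).
have sH := sigma_functional_weight id H0 (sigma_functional_integral mT m).
have -> : \int[m]_t F t = \int[m]_t H t.
  apply: (eq_sigma_functional cT.1 (sigma_functional_integral mT m) sH) => // t.
  rewrite integral_mul_indic1// integral_indic// setIT.
  have [t0|t0] := eqVneq (m [set t]) 0; first by rewrite t0 mule0.
  by rewrite indicE memNset ?subr0 ?mul1e//; exact/eqP.
apply: ge0_le_integral => //; first by move=> t _; rewrite mule_ge0.
move=> t _; rewrite /H indicE; have [Nt|Nt] := pselect (N t).
  by rewrite mem_set// subrr mul0e.
rewrite memNset// subr0 mul1e; apply: FG.
by rewrite lt0e measure_ge0 andbT; exact/eqP.
Qed.

Lemma normr_Rintegral_le_support (g : T -> R) (M c : R) : m setT = 1 ->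
  (forall t, `|g t| <= M)%R -> (0 <= c)%R ->
  (forall t, 0 < m [set t] -> (`|g t| <= c)%R) ->
  (`|Rintegral m setT g| <= c)%R.
Proof.
move=> m1 gM c0 gc.
rewrite (le_trans (le_normr_Rintegral _ (bounded_integrable mT m1 gM)))//.
rewrite -lee_fin -(Rintegral_EFin mT m1 (M := M)); last first.
  by move=> t; rewrite normr_id.
apply: (@le_trans _ _ (\int[m]_t (cst c%:E t))).
  by apply: le_integral_support => // t; rewrite ?lee_fin//; exact: gc.
by rewrite integral_cst// m1 mule1.
Qed.

End Support.

Lemma coupling_integral1 d (X : measurableType d) (R : realType)
    (mu : {measure set X -> \bar R}) (nu : set X -> \bar R)
    (q : probability (X * X)%type R) : countable_discrete X ->
  coupling mu nu q -> forall F : X -> \bar R, (forall x, 0 <= F x) ->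
  \int[q]_z F z.1 = \int[mu]_x F x.
Proof.
move=> cX cq F F0; have [_ mXX] := countable_discreteX cX cX.
have s1 := sigma_functional_comp fst (sigma_functional_integral mXX q).
apply: (eq_sigma_functional cX.1 s1 (sigma_functional_integral cX.2 mu)) => // x.
rewrite [RHS]integral_indic//; last exact: cX.2.
rewrite setIT; have [<- _] := cq [set x] (cX.2 _).
rewrite -[_ `*` _]setIT -integral_indic//.
by apply: eq_integral => u _; congr EFin; apply: eq_indic; split=> [|[]].
Qed.

Lemma coupling_integral2 d (X : measurableType d) (R : realType)
    (nu : {measure set X -> \bar R}) (mu : set X -> \bar R)
    (q : probability (X * X)%type R) : countable_discrete X ->
  coupling mu nu q -> forall F : X -> \bar R, (forall x, 0 <= F x) ->
  \int[q]_z F z.2 = \int[nu]_x F x.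
Proof.
move=> cX cq F F0; have [_ mXX] := countable_discreteX cX cX.
have s1 := sigma_functional_comp snd (sigma_functional_integral mXX q).
apply: (eq_sigma_functional cX.1 s1 (sigma_functional_integral cX.2 nu)) => // x.
rewrite [RHS]integral_indic//; last exact: cX.2.
rewrite setIT; have [_ <-] := cq [set x] (cX.2 _).
rewrite -[_ `*` _]setIT -integral_indic//.
by apply: eq_integral => u _; congr EFin; apply: eq_indic; split=> [|[]].
Qed.

Section Curvature.
Context {d : measure_display} {X : measurableType d} {R : realType}.
Variables (K : R.-pker X ~> X) (pi : probability X R).
Hypothesis cX : countable_discrete X.
Hypothesis irrK : irreducible K.
Hypothesis revK : reversible K pi.
Implicit Types (mu nu rho : set X -> \bar R) (x y : X).

Let mX : forall A : set X, measurable A := cX.2.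
Let mXX : forall A : set (X * X), measurable A := (countable_discreteX cX cX).2.
Let K1 x : K x setT = 1 := @prob_kernel _ _ _ _ _ K x.

Lemma W1_triangle mu rho nu q (c : R) : coupling mu rho q ->
  \int[q]_z graph_dist K z.1 z.2 <= c%:E ->
  W1 K mu nu <= c%:E + W1 K rho nu.
Proof.
move=> cq qc; rewrite -leeBlDl//; apply/ereal_infP => _ [q2 cq2 <-].
have [D [DE _ tri _ _]] := graph_dist_metric cX irrK revK.
have [q3 cq3 /(_ (fun z => graph_dist K z.1 z.2))] := coupling_glue cX cq cq2.
move=> /(_ _ _)/= q3le.
rewrite EFinN leeBlDl//; apply: le_trans; first by apply: ereal_inf_lbound; exists q3.
apply: le_trans (leeD qc (lexx _)); apply: q3le => [z|x y z].
  by rewrite DE lee_fin.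
by rewrite !DE -EFinD lee_fin -natrD ler_nat.
Qed.

Lemma W1_dirac_le x y : W1 K \d_x \d_y <= graph_dist K x y.
Proof.
apply: ge_ereal_inf; exists (graph_dist K x y) => //; exists \d_(x, y).
  by move=> A _; split; rewrite /= /dirac; congr EFin; apply: eq_indic => /=;
    split=> [[]|].
by rewrite integral_dirac// diracT mul1e.
Qed.

Variable kappa : R.
Hypothesis kappa_gt0 : (0 < kappa)%R.
Hypothesis ricci : coarse_ricci_ge K kappa.

(** A Bonnet-Myers bound.  A function that is 1-Lipschitz along edges satisfies
    |L g| <= 1, so in unit time the heat kernel moves mass by at most
    c0 = (e^2 - 1)/2 on average.  The triangle inequality and the contraction of
    the two Dirac masses then give d(x,y) - 2 c0 <= e^(-kappa) d(x,y).
    The distance is truncated at N because P_t is only under control on bounded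
    functions; N = d(x,y) loses nothing in the triangle inequality. *)
Lemma bounded_diameter :
  exists2 B : R, (0 <= B)%R & forall x y, graph_dist K x y <= B%:E.
Proof.
have [D [DE D0 tri sym Dedge]] := graph_dist_metric cX irrK revK.
have [p pP] := exists_heat_kernel cX ler01 ricci.
have e1 : (0 < 1 - expR (- kappa * 1))%R.
  by rewrite subr_gt0 mulr1 expR_lt1 oppr_lt0.
pose c0 : R := (1 / 2 * (expR (2 * 1) - 1))%R.
have c00 : (0 <= c0)%R.
  have := @expR_ge1Dx R (2 * 1); rewrite /c0; lra.
exists (2 * c0 / (1 - expR (- kappa * 1)))%R.
  by rewrite divr_ge0 ?mulr_ge0// ltW.
have mean x N : \int[p x]_y (minn (D x y) N)%:R%:E <= c0%:E.
  pose g y : R := (minn (D x y) N)%:R.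
  have gN y : (0 <= g y <= N%:R)%R by rewrite ler0n ler_nat geq_minr.
  have gbd y : (`|g y| <= N%:R)%R by rewrite ger0_norm//; case/andP: (gN y).
  have px1 : p x setT = 1 := probability_setT (p x).
  rewrite (Rintegral_EFin mX px1 gbd) lee_fin.
  rewrite (heat_kernel_Rintegral cX ler01 pP x gN).
  have Lg z : (`|generator K g z| <= 1)%R.
    apply: (@normr_Rintegral_le_support _ _ _ cX _ _ (2 * N%:R)%R) => //.
      by move=> y; apply: normr_increment_le.
    move=> y zy; have yz : (D y z <= 1)%N by rewrite sym; exact: Dedge.
    have le1 u v : (D u v <= 1)%N -> (g u <= g v + 1)%R.
      move=> uv; rewrite /g natr1 ler_nat.
      by have := tri x v u; rewrite (sym v u); lia.
    rewrite ler_norml; apply/andP; split.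
      by have := le1 z y; rewrite sym => /(_ yz); lra.
    by have := le1 y z yz; lra.
  have := semigroup_order1 mX x ler01 gbd Lg.
  by rewrite {2}/g D0 min0n subr0; apply: le_trans; exact: ler_norm.
move=> x y; rewrite DE lee_fin ler_pdivlMr//.
have := ricci \d_x \d_y ler01.
have adjE z : semigroup_adj K 1 \d_z = p z.
  apply/funext => A.
  by rewrite /semigroup_adj integral_dirac// diracT mul1e pP.
have Wle : W1 K \d_x \d_y <= (D x y)%:R%:E by rewrite -DE; exact: W1_dirac_le.
move=> /le_trans /(_ (lee_wpmul2l _ Wle)); rewrite lee_fin expR_ge0 => /(_ isT).
rewrite /= !adjE -EFinM.
suff lower : ((D x y)%:R - 2 * c0)%:E <= W1 K (p x) (p y).
  by move=> /(le_trans lower); rewrite lee_fin; lra.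
apply/ereal_infP => _ [q cq <-].
set N := D x y.
pose gx u : \bar R := (minn (D x u) N)%:R%:E.
pose gy u : \bar R := (minn (D y u) N)%:R%:E.
have : N%:R%:E <= \int[q]_z (gx z.1 + graph_dist K z.1 z.2 + gy z.2).
  have -> : N%:R%:E = \int[q]_z (cst N%:R%:E z).
    by rewrite integral_prob_cst.
  apply: ge0_le_integral => //; first by move=> z _; rewrite lee_fin.
  move=> [u v] _ /=; rewrite DE -!EFinD lee_fin -!natrD ler_nat.
  have := tri x u y; have := tri u v y; rewrite (sym v y) /N; lia.
have D_ge0 u v : 0 <= graph_dist K u v by rewrite DE lee_fin.
have gx0 u : 0 <= gx u by rewrite lee_fin.
have gy0 u : 0 <= gy u by rewrite lee_fin.
rewrite ge0_integralD//; last by move=> z _; rewrite adde_ge0.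
rewrite ge0_integralD//.
rewrite (coupling_integral1 cX cq (F := gx))//.
rewrite (coupling_integral2 cX cq (F := gy))//.
move=> le1; rewrite EFinB leeBlDr//; apply: (le_trans le1).
rewrite (_ : (2 * c0)%:E = c0%:E + c0%:E); last by rewrite -EFinD; congr EFin; ring.
rewrite [X in X + _ <= _]addeC -addeA; apply: leeD => //.
by apply: leeD; exact: mean.
Qed.

End Curvature.

(** * Transport along the heat flow *)

Section FlowCoupling.
Context {d : measure_display} {X : measurableType d} {R : realType}.
Hypothesis cX : countable_discrete X.
Variables (m : probability X R) (k : X -> probability X R).
Hypothesis symk : forall x y, k x [set y] * m [set x] = k y [set x] * m [set y].
Variable f : X -> R.
Hypothesis densf : prob_density m f.

Let mX : forall A : set X, measurable A := cX.2.
Let mXX : forall A : set (X * X), measurable A := (countable_discreteX cX cX).2.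
Let f0 x : (0 <= f x)%R := densf.1 x.
Local Notation phi := (flow m k).

Lemma density_measureE A :
  density_measure f m A = \int[m]_x ((f x)%:E * (\1_A x)%:E).
Proof.
rewrite /density_measure integral_mkcond; apply: eq_integral => x _.
by rewrite /patch indicE; case: (x \in A); rewrite ?mule1// mule0.
Qed.

(** For a reversible kernel k, transport f m to its image under k by moving only
    the net flow: mass (f x - f y)^+ from x to y along m(dx) k(x,dy), while
    min(f x, f y) stays in place.  Since (f x - f y)^+ + min(f x, f y) = f x, the
    first marginal is f m; exchanging x and y turns the same identity into the
    second marginal. *)
Lemma flow_coupling : exists2 q : probability (X * X)%type R,
  coupling (density_measure f m) (fun A => \int[m]_x ((f x)%:E * k x A)) q &
  forall F, (forall z, 0 <= F z) -> (forall x, F (x, x) = 0) ->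
    \int[q]_z F z = phi (fun z => (Num.max (f z.1 - f z.2) 0)%:E * F z).
Proof.
pose net (z : X * X) := (Num.max (f z.1 - f z.2) 0)%:E.
pose stay (z : X * X) := (Num.min (f z.1) (f z.2))%:E.
have net0 z : 0 <= net z by rewrite lee_fin le_max lexx orbT.
have stay0 z : 0 <= stay z by rewrite lee_fin le_min !f0.
have sphi : sigma_functional phi by exact: sigma_functional_flow.
pose I (F : X * X -> \bar R) :=
  phi (fun z => net z * F z) + phi (fun z => stay z * F (z.1, z.1)).
have sI : sigma_functional I.
  apply: sigma_functionalD; first exact: (sigma_functional_weight id net0 sphi).
  exact: (sigma_functional_weight (fun z => (z.1, z.1)) stay0 sphi).
have netstay z : net z + stay z = (f z.1)%:E.
  by rewrite -EFinD; congr EFin; rewrite /Num.max /Num.min subr_lt0; case: ltP => _; ring.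
have I1 (G : X -> \bar R) : (forall x, 0 <= G x) ->
    I (fun z => G z.1) = \int[m]_x ((f x)%:E * G x).
  move=> G0; rewrite /I -(flowD cX); [|by move=> z; rewrite mule_ge0..].
  apply: eq_integral => x _.
  transitivity (\int[k x]_y (cst ((f x)%:E * G x) y)).
    by apply: eq_integral => y _; rewrite -ge0_muleDl// netstay.
  by rewrite integral_prob_cst.
have I2 A : I (fun z => (\1_A z.2)%:E) = \int[m]_x ((f x)%:E * k x A).
  have ind0 (x : X) : 0 <= (\1_A x)%:E :> \bar R by rewrite lee_fin.
  rewrite /I (flow_swap cX symk) /=; last by move=> z; rewrite mule_ge0.
  rewrite -(flowD cX)/=; [|by move=> z; rewrite mule_ge0..].
  have -> : (fun z : X * X => net (z.2, z.1) * (\1_A z.1)%:E + stay z * (\1_A z.1)%:E) =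
            (fun z => (f z.2)%:E * (\1_A z.1)%:E).
    apply/funext => z; rewrite -ge0_muleDl//; congr (_ * _).
    by rewrite -[RHS](netstay (z.2, z.1)) /stay/= minC.
  rewrite (flow_swap cX symk) /=; last by move=> z; rewrite mule_ge0// lee_fin.
  apply: eq_integral => x _ /=.
  by rewrite ge0_integralZl ?lee_fin// integral_indic//= setIT.
have [|q qI] := sigma_functional_prob (countable_discreteX cX cX) sI.
  rewrite (I1 (fun=> 1))//; under eq_integral => x _ do rewrite mule1.
  by case: densf.
exists q => [A _|F F0 Fd].
  split.
    rewrite -[_ `*` _]setIT -integral_indic// qI; last by move=> z; rewrite lee_fin.
    rewrite density_measureE -I1; last by move=> x; rewrite lee_fin.
    by congr I; apply/funext => z; congr EFin; apply: eq_indic; split=> [[]|].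
  rewrite -[_ `*` _]setIT -integral_indic// qI; last by move=> z; rewrite lee_fin.
  rewrite -I2.
  by congr I; apply/funext => z; congr EFin; apply: eq_indic; split=> [[]|].
rewrite qI// /I [X in _ + X](_ : _ = 0) ?adde0//.
rewrite /flow integral0_eq// => x _; rewrite integral0_eq// => y _.
by rewrite Fd mule0.
Qed.

End FlowCoupling.

Section ContractionEstimate.
Context {d : measure_display} {X : measurableType d} {R : realType}.
Variables (K : R.-pker X ~> X) (pi : probability X R) (kappa : R).
Hypothesis cX : countable_discrete X.
Hypothesis irrK : irreducible K.
Hypothesis revK : reversible K pi.
Hypothesis kappa_gt0 : (0 < kappa)%R.
Hypothesis ricci : coarse_ricci_ge K kappa.
Variable f : X -> R.
Hypothesis densf : prob_density pi f.

Let mX : forall A : set X, measurable A := cX.2.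
Let mXX : forall A : set (X * X), measurable A := (countable_discreteX cX cX).2.
Let K1 x : K x setT = 1 := @prob_kernel _ _ _ _ _ K x.
Let f0 x : (0 <= f x)%R := densf.1 x.

(** Equal to half the integral of |f x - f y| against pi(dx) K(x,dy): the rate at
    which the heat flow transports f pi. *)
Definition downhill_flow : \bar R :=
  flow pi K (fun z => (Num.max (f z.1 - f z.2) 0)%:E).

Lemma downhill_le x y : (0 <= Num.max (f x - f y) 0 <= f x)%R.
Proof.
by rewrite le_max lexx orbT ge_max f0 andbT lerBlDr lerDl f0.
Qed.

Lemma downhill_flow_fin : exists2 a : R, (0 <= a)%R & downhill_flow = a%:E.
Proof.
have a0 : 0 <= downhill_flow.
  apply: integral_ge0 => x _; apply: integral_ge0 => y _.
  by rewrite lee_fin; case/andP: (downhill_le x y).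
have a1 : downhill_flow <= 1.
  rewrite -(densf.2); apply: ge0_le_integral => //.
    move=> x _; apply: integral_ge0 => y _.
    by rewrite lee_fin; case/andP: (downhill_le x y).
  move=> x _; rewrite -[leRHS]mule1 -(K1 x) -integral_cst//.
  apply: ge0_le_integral => //.
    by move=> y _; rewrite lee_fin; case/andP: (downhill_le x y).
  by move=> y _; rewrite lee_fin; case/andP: (downhill_le x y).
have fin : downhill_flow \is a fin_num.
  by rewrite ge0_fin_numE// (le_lt_trans a1)// ltry.
by exists (fine downhill_flow); [exact: fine_ge0|rewrite fineK].
Qed.

Lemma density_probability : exists2 mu : probability X R,
  (mu : set X -> \bar R) = density_measure f pi &
  forall F, (forall x, 0 <= F x) -> \int[mu]_x F x = \int[pi]_x ((f x)%:E * F x).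
Proof.
have f0' x : 0 <= (f x)%:E by rewrite lee_fin.
have sI := sigma_functional_weight id f0' (sigma_functional_integral mX pi).
have [|mu muI] := sigma_functional_prob cX sI.
  by under eq_integral => x _ do rewrite mule1; case: densf.
exists mu => //; apply/funext => A.
by rewrite density_measureE//= -[A in LHS]setIT -integral_indic// muI.
Qed.

(** Any two probabilities have a coupling, the independent one, and the diameter
    is finite. *)
Lemma W1_finite (mu : probability X R) :
  exists2 w : R, (0 <= w)%R & W1 K mu pi = w%:E.
Proof.
have [D [DE _ _ _ _]] := graph_dist_metric cX irrK revK.
have [B B0 dB] := bounded_diameter cX irrK revK kappa_gt0 ricci.
have W0 : 0 <= W1 K mu pi.
  apply/ereal_infP => _ [q _ <-]; apply: integral_ge0 => z _.
  by rewrite DE lee_fin.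
have WB : W1 K mu pi <= B%:E.
  have sI := sigma_functional_flow cX mu (fun=> pi).
  have [|q qI] := sigma_functional_prob (countable_discreteX cX cX) sI.
    by rewrite /flow/= !integral_prob_cst.
  apply: ge_ereal_inf; eexists; first exists q; [|reflexivity|].
    move=> A _; split.
      rewrite -[_ `*` _]setIT -integral_indic// qI; last by move=> z; rewrite lee_fin.
      rewrite -[A in RHS]setIT -integral_indic//; apply: eq_integral => x _.
      transitivity (\int[pi]_y (cst (\1_A x)%:E y)).
        by apply: eq_integral => y _; congr EFin; apply: eq_indic; split=> [[]|].
      by rewrite integral_prob_cst.
    rewrite -[_ `*` _]setIT -integral_indic// qI; last by move=> z; rewrite lee_fin.
    transitivity (\int[mu]_x (cst (pi A) x)).
      apply: eq_integral => x _; rewrite /= -[A in RHS]setIT -integral_indic//.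
      by apply: eq_integral => y _; congr EFin; apply: eq_indic; split=> [[]|].
    by rewrite integral_prob_cst.
  apply: (@le_trans _ _ (\int[q]_z cst B%:E z)).
    by apply: ge0_le_integral => // z _; rewrite ?DE ?lee_fin// -lee_fin -DE.
  by rewrite integral_prob_cst.
have fin : W1 K mu pi \is a fin_num by rewrite ge0_fin_numE// (le_lt_trans WB)// ltry.
by exists (fine (W1 K mu pi)); [exact: fine_ge0|rewrite fineK].
Qed.

(** For fixed x the cost is P_t g x with g y = (f x - f y)^+ d(x,y), which
    vanishes at x; its first-order expansion is t L g x, in which d <= 1 as K only
    charges neighbours.  Bounding the remainder needs g <= B f x, that is, the
    bounded diameter. *)
Lemma semigroup_cost (t : R) (p : X -> probability X R) (B : R) : (0 <= t)%R ->
  is_heat_kernel K t p -> (0 <= B)%R -> (forall x y, graph_dist K x y <= B%:E) ->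
  flow pi p (fun z => (Num.max (f z.1 - f z.2) 0)%:E * graph_dist K z.1 z.2) <=
  t%:E * downhill_flow + (B * (expR (2 * t) - 1 - 2 * t))%:E.
Proof.
move=> t0 pP B0 dB.
have [D [DE D0 tri sym Dedge]] := graph_dist_metric cX irrK revK.
set eta := (expR (2 * t) - 1 - 2 * t)%R.
have eta0 : (0 <= eta)%R by rewrite /eta; have := @expR_ge1Dx R (2 * t); lra.
have up0 x y : 0 <= (Num.max (f x - f y) 0)%:E :> \bar R.
  by rewrite lee_fin; case/andP: (downhill_le x y).
have -> : t%:E * downhill_flow + (B * eta)%:E =
    \int[pi]_x (t%:E * \int[K x]_y (Num.max (f x - f y) 0)%:E + (B * eta)%:E * (f x)%:E).
  rewrite ge0_integralD//; last 2 first.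
  - by move=> x _; rewrite mule_ge0// ?lee_fin//; exact: integral_ge0.
  - by move=> x _; rewrite mule_ge0// lee_fin ?mulr_ge0.
  rewrite ge0_integralZl ?lee_fin//; last by move=> x _; exact: integral_ge0.
  rewrite ge0_integralZl ?lee_fin ?mulr_ge0//; last by move=> x _; rewrite lee_fin.
  by rewrite (densf.2) mule1.
apply: ge0_le_integral => //.
  by move=> x _; apply: integral_ge0 => y _; rewrite mule_ge0// DE lee_fin.
move=> x _ /=.
pose g y := (Num.max (f x - f y) 0 * (D x y)%:R)%R.
have gB y : (0 <= g y <= f x * B)%R.
  have /andP[u0 uf] := downhill_le x y.
  rewrite mulr_ge0//= ler_pM//.
  by have := dB x y; rewrite DE lee_fin.
have gbd y : (`|g y| <= f x * B)%R by rewrite ger0_norm; case/andP: (gB y).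
have px1 : p x setT = 1 := probability_setT (p x).
have -> : \int[p x]_y ((Num.max (f x - f y) 0)%:E * graph_dist K x y) =
    (semigroup K t g x)%:E.
  rewrite -(heat_kernel_Rintegral cX t0 pP x gB) -(Rintegral_EFin mX px1 gbd).
  by apply: eq_integral => y _; rewrite DE.
have gx : g x = 0%R by rewrite /g D0 mulr0.
have Lg : (generator K g x)%:E <= \int[K x]_y (Num.max (f x - f y) 0)%:E.
  rewrite /generator -(Rintegral_EFin mX (K1 x) (M := f x * B)%R); last first.
    by move=> y; rewrite gx subr0.
  under eq_integral => y _ do rewrite gx subr0.
  apply: le_integral_support => //.
  - by move=> y; rewrite lee_fin; case/andP: (gB y).
  - move=> y xy; rewrite lee_fin /g ler_piMr//.
      by case/andP: (downhill_le x y).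
    by rewrite lern1; exact: Dedge.
apply: (@le_trans _ _ (t%:E * (generator K g x)%:E + (B * eta)%:E * (f x)%:E)).
  rewrite -!EFinM -EFinD lee_fin.
  have := semigroup_order2 K mX x t0 gbd; rewrite gx subr0 -/eta ler_norml.
  by move=> /andP[_]; lra.
by rewrite leeD2r// lee_wpmul2l// lee_fin.
Qed.

(** Triangle inequality through P_t^* (f pi): the first leg is the cost of the
    net-flow coupling, the second contracts because P_t^* pi = pi. *)
Lemma W1_heat_flow_le (w a t : R) : W1 K (density_measure f pi) pi = w%:E ->
  downhill_flow = a%:E -> (0 <= t)%R ->
  forall B, (0 <= B)%R -> (forall x y, graph_dist K x y <= B%:E) ->
  (w <= t * a + B * (expR (2 * t) - 1 - 2 * t) + expR (- kappa * t) * w)%R.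
Proof.
move=> wE aE t0 B B0 dB.
have [mu muE muI] := density_probability.
have [p pP] := exists_heat_kernel cX t0 ricci.
have symp := heat_kernel_reversible cX revK t0 pP.
have adj_mu : semigroup_adj K t mu = fun A => \int[pi]_x ((f x)%:E * p x A).
  apply/funext => A; rewrite /semigroup_adj muI; last by move=> x; rewrite -pP.
  by apply: eq_integral => x _; rewrite pP.
have adj_pi : semigroup_adj K t pi = pi.
  apply/funext => A; rewrite /semigroup_adj.
  transitivity (flow pi p (fun z => (\1_A z.2)%:E)).
    by apply: eq_integral => x _; rewrite -pP integral_indic//= setIT.
  rewrite (flow_swap cX symp); last by move=> z; rewrite lee_fin.
  rewrite -[A in RHS]setIT -integral_indic//; apply: eq_integral => x _ /=.
  by rewrite integral_prob_cst.
have [q cq qI] := flow_coupling cX symp densf.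
have [D [DE D0 _ _ _]] := graph_dist_metric cX irrK revK.
have cost : \int[q]_z graph_dist K z.1 z.2 <=
    (t * a + B * (expR (2 * t) - 1 - 2 * t))%:E.
  rewrite qI/=; last 2 first.
  - by move=> z; rewrite DE lee_fin.
  - by move=> x; rewrite DE D0.
  by rewrite EFinD EFinM -aE; exact: semigroup_cost.
have := W1_triangle cX irrK revK pi cq cost.
rewrite wE => /le_trans W1le; rewrite -lee_fin [leRHS]EFinD; apply: W1le.
apply: leeD => //; have := ricci mu pi t0.
by rewrite adj_mu adj_pi muE wE -EFinM.
Qed.

(** Divide [W1_heat_flow_le] by t and let t tend to 0.  The explicit constants
    come from e^(2t) <= 1 + 2t + 8t^2 for t <= 1/4 and
    e^(-kappa t) <= 1 / (1 + kappa t), both consequences of 1 + x <= e^x. *)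
Lemma W1_le_downhill_flow (w a : R) : W1 K (density_measure f pi) pi = w%:E ->
  downhill_flow = a%:E -> (0 <= w)%R -> (0 <= a)%R -> (kappa * w <= a)%R.
Proof.
move=> wE aE w0 a0.
have [B B0 dB] := bounded_diameter cX irrK revK kappa_gt0 ricci.
pose C := (kappa * a + 8 * B + 2 * kappa * B)%R.
have C0 : (0 <= C)%R by rewrite /C !addr_ge0// !mulr_ge0// ltW.
have small (t : R) : (0 < t)%R -> (t <= 4^-1)%R -> (kappa * w <= a + t * C)%R.
  move=> t0 t4.
  have := W1_heat_flow_le wE aE (ltW t0) B0 dB.
  set eta := (_ - _ - _)%R; set e := expR _ => le1.
  have eta8 : (eta <= 8 * t ^+ 2)%R.
    have h : ((1 - 2 * t) * expR (2 * t) <= 1)%R.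
      have := @expR_ge1Dx R (- (2 * t)); rewrite expRN => h.
      by rewrite -ler_pdivlMr ?expR_gt0// mul1r.
    have t2 : (0 < 1 - 2 * t)%R by lra.
    have t3 : (0 <= t ^+ 2 * (1 - 4 * t))%R by rewrite mulr_ge0 ?sqr_ge0//; lra.
    rewrite -(ler_pM2l t2) /eta !mulrBr (mulrC _ (2 * t)%R).
    by rewrite expr2 in t3 *; nra.
  have ekt : (e * (1 + kappa * t) <= 1)%R.
    rewrite /e mulNr expRN mulrC ler_pdivrMr ?expR_gt0// mul1r.
    exact: expR_ge1Dx.
  have k0 := kappa_gt0.
  have kt0 : (0 < kappa * t)%R by rewrite mulr_gt0.
  have le2 : (w * (1 + kappa * t) <= (t * a + B * (8 * t ^+ 2)) * (1 + kappa * t) + w)%R.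
    have le3 : (w <= t * a + B * (8 * t ^+ 2) + e * w)%R.
      by rewrite (le_trans le1)// lerD2r lerD2l ler_wpM2l.
    have : (w * (1 + kappa * t) <=
        (t * a + B * (8 * t ^+ 2) + e * w) * (1 + kappa * t))%R.
      by rewrite ler_wpM2r//; lra.
    have : (e * w * (1 + kappa * t) <= w)%R.
      by rewrite mulrAC -[leRHS]mul1r ler_wpM2r.
    by lra.
  have le4 : (t * (kappa * w) <= t * ((a + B * 8 * t) * (1 + kappa * t)))%R by nra.
  rewrite ler_pM2l// in le4; apply: (le_trans le4); rewrite /C.
  have : (t * (kappa * B) <= 4^-1 * (kappa * B))%R.
    by rewrite ler_wpM2r// mulr_ge0// ltW.
  move=> h; have : (t * (t * (kappa * B)) <= t * (4^-1 * (kappa * B)))%R.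
    by rewrite ler_pM2l.
  by lra.
apply/ler_addgt0Pr => e e0.
pose t : R := (Num.min 4^-1 (e / (C + 1)))%R.
have t0 : (0 < t)%R by rewrite lt_min invr_gt0 ltr0n/= divr_gt0//; lra.
have t4 : (t <= 4^-1)%R by rewrite ge_min lexx.
apply: (le_trans (small t t0 t4)); rewrite lerD2l.
have : (t <= e / (C + 1))%R by rewrite ge_min lexx orbT.
rewrite ler_pdivlMr; last by lra.
by lra.
Qed.

End ContractionEstimate.

(** * The Cauchy-Schwarz bound by the Fisher information *)

(** The optimal l is b / a; if a = 0, large l forces b = 0. *)
Lemma discriminant_le {R : realFieldType} (a b c : R) : (0 <= a)%R -> (0 <= b)%R ->
  (forall l : R, (0 <= l)%R -> (2 * l * b <= l ^+ 2 * a + c)%R) ->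
  (b ^+ 2 <= a * c)%R.
Proof.
move=> a0 b0 H; have [a00|an0] := eqVneq a 0%R.
  have [->|bn0] := eqVneq b 0%R; first by rewrite a00 expr0n mul0r.
  have bp : (0 < b)%R by rewrite lt_neqAle eq_sym bn0.
  have := H ((`|c| + 1) / b)%R; rewrite divr_ge0 ?addr_ge0// => /(_ isT).
  rewrite a00 mulr0 add0r -mulrA divfK//; have := ler_norm c; have := normr_ge0 c.
  by lra.
have ap : (0 < a)%R by rewrite lt_neqAle eq_sym an0.
have := H (b / a)%R; rewrite divr_ge0// => /(_ isT).
rewrite (_ : (b / a) ^+ 2 * a = b ^+ 2 / a)%R; last by field.
rewrite (_ : 2 * (b / a) * b = 2 * (b ^+ 2 / a))%R; last by field.
move=> h; have : (b ^+ 2 / a <= c)%R by lra.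
by rewrite ler_pdivrMr// mulrC.
Qed.

Section FisherInformation.
Context {d : measure_display} {X : measurableType d} {R : realType}.
Variables (K : R.-pker X ~> X) (pi : probability X R).
Hypothesis cX : countable_discrete X.
Hypothesis revK : reversible K pi.
Variable f : X -> R.
Hypothesis densf : prob_density pi f.

Let mX : forall A : set X, measurable A := cX.2.
Let K1 x : K x setT = 1 := @prob_kernel _ _ _ _ _ K x.
Let f0 x : (0 <= f x)%R := densf.1 x.
Local Notation phi := (flow pi K).

Lemma jump_rate_bounds x : 0 <= jump_rate K x <= 1.
Proof.
have Kx : K x [set x] <= 1 by rewrite -(K1 x) le_measure ?inE.
have Kfin : K x [set x] \is a fin_num.
  by rewrite ge0_fin_numE// (le_lt_trans Kx)// ltry.
by rewrite /jump_rate leeBrDr// add0e Kx leeBlDr// leeDl.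
Qed.

Lemma max_jump_rate_fin : exists j : R, [/\ max_jump_rate K = j%:E, (j <= 1)%R
  & forall x, jump_rate K x <= j%:E].
Proof.
have Jle x : jump_rate K x <= max_jump_rate K by apply: ereal_sup_ubound; exists x.
have J0 : 0 <= max_jump_rate K.
  by apply: le_trans (Jle point); case/andP: (jump_rate_bounds point).
have J1 : max_jump_rate K <= 1.
  by apply: ge_ereal_sup => _ [x _ <-]; case/andP: (jump_rate_bounds x).
have fin : max_jump_rate K \is a fin_num.
  by rewrite ge0_fin_numE// (le_lt_trans J1)// ltry.
by exists (fine (max_jump_rate K)); split; rewrite ?fineK// -lee_fin fineK.
Qed.

Let s x := Num.sqrt (f x).
Let S (z : X * X) : \bar R := ((s z.1 - s z.2) ^+ 2)%:E.
Let U (z : X * X) : \bar R := (Num.max (f z.1 - f z.2) 0)%:E.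
Let N (z : X * X) : \bar R := ((z.1 != z.2)%:R * f z.1)%:E.

Lemma fisher_infoE : fisher_info K pi f = 2%:E * phi S.
Proof.
have pos x : 0 <= \int[K x]_y ((s y - s x) ^+ 2)%:E.
  by apply: integral_ge0 => y _; rewrite lee_fin sqr_ge0.
have SE : \int[pi]_x \int[K x]_y ((s y - s x) ^+ 2)%:E = phi S.
  by apply: eq_integral => x _; apply: eq_integral => y _; rewrite /S/= -sqrrN opprB.
have half : (4 * 2^-1 = 2 :> R)%R by field.
rewrite /fisher_info /carre_du_champ ge0_integralZl.
- by rewrite SE muleA -EFinM half.
- exact: measurableT.
- exact: measurable_fun_discrete.
- by move=> x _; exact: pos.
- by rewrite lee_fin invr_ge0.
Qed.

(** The integral is that of f J against pi. *)
Lemma leaving_flow (j : R) : (forall x, jump_rate K x <= j%:E) -> phi N <= j%:E.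
Proof.
move=> Jj; have j0 : (0 <= j)%R.
  by rewrite -lee_fin (le_trans _ (Jj point))//; case/andP: (jump_rate_bounds point).
apply: (@le_trans _ _ (\int[pi]_x (j%:E * (f x)%:E))); last first.
  rewrite ge0_integralZl ?lee_fin//; first by rewrite (densf.2) mule1.
  by move=> x _; rewrite lee_fin.
apply: ge0_le_integral => //.
  by move=> x _; apply: integral_ge0 => y _; rewrite lee_fin mulr_ge0.
move=> x _; have -> : \int[K x]_y N (x, y) = (f x)%:E * jump_rate K x.
  transitivity (\int[K x]_y ((f x)%:E * (x != y)%:R%:E)).
    by apply: eq_integral => y _; rewrite -EFinM mulrC.
  rewrite ge0_integralZl ?lee_fin//.
  congr ((f x)%:E * _); rewrite /jump_rate; apply/esym.
  have Kfin : \int[K x]_y (\1_[set x] y)%:E \is a fin_num.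
    rewrite integral_indic// setIT ge0_fin_numE//.
    by rewrite (@le_lt_trans _ _ 1) ?ltry// -(K1 x) le_measure ?inE.
  rewrite -[K x [set x]](_ : \int[K x]_y (\1_[set x] y)%:E = _); last first.
    by rewrite integral_indic// setIT.
  apply/eqP; rewrite sube_eq//; last by rewrite fin_num_adde_defl.
  rewrite -ge0_integralD//.
  apply/eqP; transitivity (\int[K x]_y (cst 1 y)).
    by rewrite integral_cst// mul1e K1.
  apply: eq_integral => y _; rewrite indicE in_set1 -EFinD /=.
  by case: (eqVneq y x) => _ /=; rewrite ?addr0 ?add0r.
by rewrite muleC; apply: lee_wpmul2r; rewrite ?lee_fin.
Qed.

(** With a = sqrt(f x) and b = sqrt(f y), x <> y:
    2 l |a^2 - b^2| <= l^2 (a - b)^2 + (a + b)^2, and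
    (a + b)^2 + (a - b)^2 = 2 (f x + f y).  On the diagonal both sides vanish,
    which is how 1[x <> y], and with it J, enters. *)
Lemma weighted_amgm (l : R) z : (0 <= l)%R ->
  (2 * l)%:E * (U z + U (z.2, z.1)) + S z <=
  (l ^+ 2)%:E * S z + 2%:E * (N z + N (z.2, z.1)).
Proof.
move=> l0; rewrite /U /S /N -!EFinD lee_fin /=.
have [->|ne] := eqVneq z.1 z.2.
  by rewrite !subrr expr0n maxxx /= !(mul0r, mulr0, addr0).
rewrite /= !mul1r.
have fE x : f x = (s x ^+ 2)%R by rewrite sqr_sqrtr.
have s1 := sqrtr_ge0 (f z.1); have s2 := sqrtr_ge0 (f z.2).
rewrite -/(s _) in s1; rewrite -/(s _) in s2; rewrite !fE.
set a := s z.1 in s1 *; set b := s z.2 in s2 *.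
have h1 := sqr_ge0 (l * (a - b) - (a + b)).
have h2 := sqr_ge0 (l * (b - a) - (a + b)).
have [ab|ab] := leP a b.
  rewrite max_r ?subr_le0 ?lerXn2r//; rewrite max_l ?subr_ge0 ?lerXn2r//.
  by rewrite !expr2 in h1 h2 *; lra.
have /ltW ba := ab.
rewrite max_l ?subr_ge0 ?lerXn2r//; rewrite max_r ?subr_le0 ?lerXn2r//.
by rewrite !expr2 in h1 h2 *; lra.
Qed.

(** Integrating [weighted_amgm] gives, with al = I/2,
    4 l a <= l^2 al + (4 j - al) for all l >= 0, hence
    4 a^2 <= al (4 j - al), that is a^2 <= (1/2) I (j - I/8). *)
Lemma downhill_flow_fisher (j a : R) : (forall x, jump_rate K x <= j%:E) ->
  downhill_flow K pi f = a%:E -> (0 <= a)%R ->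
  exists i : R, [/\ fisher_info K pi f = i%:E, (0 <= i)%R,
    (0 <= j - 8^-1 * i)%R & (a ^+ 2 <= i * (j - 8^-1 * i))%R].
Proof.
move=> Jj aE a0.
have S0 z : 0 <= S z by rewrite lee_fin sqr_ge0.
have U0 z : 0 <= U z by rewrite lee_fin le_max lexx orbT.
have N0 z : 0 <= N z by rewrite lee_fin mulr_ge0.
have NE : phi N <= j%:E := leaving_flow Jj.
have UE : phi U = a%:E by [].
have amgm l : (0 <= l)%R ->
    (2 * l)%:E * (a%:E + a%:E) + phi S <= (l ^+ 2)%:E * phi S + 2%:E * (j%:E + j%:E).
  move=> l0.
  have l20 : (0 <= 2 * l)%R by rewrite mulr_ge0.
  have US0 z : 0 <= U z + U (z.2, z.1) by rewrite adde_ge0.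
  have NS0 z : 0 <= N z + N (z.2, z.1) by rewrite adde_ge0.
  have left0 z : 0 <= (2 * l)%:E * (U z + U (z.2, z.1)) + S z.
    by rewrite adde_ge0// mule_ge0.
  have := le_flow cX pi K left0 (fun z => weighted_amgm z l0).
  rewrite (flowD cX)//; last by move=> z; rewrite mule_ge0// lee_fin.
  rewrite (flowZ cX)// (flowD cX)// -(flow_swap cX revK U0) UE => le1.
  apply: (le_trans le1).
  rewrite (flowD cX); last 2 first.
  - by move=> z; rewrite mule_ge0// lee_fin sqr_ge0.
  - by move=> z; rewrite mule_ge0// lee_fin.
  rewrite (flowZ cX) ?sqr_ge0// (flowZ cX)// (flowD cX)// -(flow_swap cX revK N0).
  by rewrite leeD2l// lee_wpmul2l ?lee_fin// leeD.
have phiS_ge0 : 0 <= phi S by apply: integral_ge0 => x _; exact: integral_ge0.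
have Sfin : phi S \is a fin_num.
  rewrite ge0_fin_numE//; have := amgm 0%R (lexx _).
  rewrite mulr0 expr0n !mul0e !add0e => /le_lt_trans; apply.
  by rewrite -EFinD -EFinM ltry.
move: amgm phiS_ge0 fisher_infoE; rewrite -(fineK Sfin).
move: (fine _) => al amgm; rewrite lee_fin => al0 ->.
have real_amgm l : (0 <= l)%R -> (2 * l * (2 * a) <= l ^+ 2 * al + (4 * j - al))%R.
  by move=> /amgm; rewrite -!EFinD lee_fin; lra.
have alj : (0 <= 4 * j - al)%R by have := real_amgm 0%R (lexx _); lra.
have a2 : ((2 * a) ^+ 2 <= al * (4 * j - al))%R.
  by apply: discriminant_le => //; rewrite mulr_ge0.
exists (2 * al)%R; split=> //; [by rewrite mulr_ge0|lra|].
by have : (0 <= al * (4 * j - al))%R; [rewrite mulr_ge0|rewrite exprMn in a2; lra].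
Qed.

End FisherInformation.

(** * The transport-information inequality *)

Theorem theorem1p13 (d : measure_display) (X : measurableType d) (R : realType)
    (K : R.-pker X ~> X) (pi : probability X R) (kappa_c : R) :
  countable_discrete X ->
  irreducible K ->
  reversible K pi ->
  (0 < kappa_c)%R ->
  coarse_ricci_ge K kappa_c ->
  forall f : X -> R, prob_density pi f ->
    W1 K (density_measure f pi) pi ^+ 2
      <= (kappa_c ^- 2)%:E
         * (fisher_info K pi f
            * (max_jump_rate K - (8^-1)%:E * fisher_info K pi f))
    /\
    (kappa_c ^- 2)%:E
         * (fisher_info K pi f
            * (max_jump_rate K - (8^-1)%:E * fisher_info K pi f))
      <= (kappa_c ^- 2)%:E * fisher_info K pi f.
Proof.
move=> cX irrK revK k0 ricci f densf.
have [a a0 aE] := downhill_flow_fin K cX densf.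
have [mu muE _] := density_probability cX densf.
have [w w0] := W1_finite cX irrK revK k0 ricci mu; rewrite muE => wE.
have kwa := W1_le_downhill_flow cX irrK revK k0 ricci densf wE aE w0 a0.
have [j [jE j1 Jj]] := max_jump_rate_fin K cX.
have [i [iE i0 ji0 a2]] := downhill_flow_fisher cX revK densf Jj aE a0.
have k2 : (0 < kappa_c ^+ 2)%R by rewrite exprn_gt0.
rewrite wE iE jE; split.
  rewrite -EFin_expe -!EFinM lee_fin mulrC ler_pdivlMr//.
  apply: le_trans a2; rewrite -exprMn mulrC lerXn2r// nnegrE//.
  by rewrite mulr_ge0// ltW.
rewrite -!EFinM lee_fin ler_wpM2l//; first by rewrite invr_ge0 ltW.
by rewrite ler_piMr//; lra.
Qed.
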